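(* Let $c_0,c_1,c_2,\dots$ be formal (infinitesimal) variables, $P(X)=\sum_{a\ge 0}c_aX^a$, $A(v,y)=v^{-1}P\bigl(v(1+y)^2\bigr)$, and $$T(v,y)\;=\;y+\sum_{r=1}^\infty\frac1{r!}\Bigl(\frac1y\frac{d}{dy}\Bigr)^{r-1}\Bigl(\frac{1+y}{y}\,A(v,y)^r\Bigr)\;\in\;\mathbb{Q}[v^{\pm1},y^{\pm1}][[c_0,c_1,\dots]].$$ Then for every integer $N\ge 1$, $$\bigl[v^{N-1}y^{-2}\bigr]\biggl(\frac{T(v,y)+y}{2}\biggr)^{-N}\;=\;-\,\frac14\,N\binom{2N+2}{N+1}\,c_N .$$
   Context: $[v^{m}y^{k}]F$ denotes the coefficient of $v^my^k$ in $F$, a formal power series in the $c_a$. Since $\frac{T(v,y)+y}{2}=y(1+\varepsilon)$ with $\varepsilon$ in the ideal generated by the $c_a$, its $(-N)$-th power is defined as $y^{-N}(1+\varepsilon)^{-N}$ expanded as a power series in the $c_a$. The operator $\frac1y\frac{d}{dy}$ acts coefficientwise on Laurent polynomials in $y$. *)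

(* Defs.v *)
From mathcomp Require Import all_boot all_order all_algebra.
Set Implicit Arguments. Unset Strict Implicit. Unset Printing Implicit Defensive.
Import Order.TTheory GRing.Theory Num.Theory.
Local Open Scope ring_scope.

(* Laurent polynomials in v, y over Q.                                 *)
(* An element (p, (a, b)) with p : {poly {poly rat}} represents        *)
(*    p(v, y) * v^(-a) * y^(-b),                                       *)
(* where the OUTER polynomial variable of p is y and the INNER one v,  *)
(* i.e. p = \sum_j p`_j(v) y^j.  Only coefficient extraction [lcoef]   *)
(* is observed, so non-uniqueness of representation is harmless.       *)
Definition lau := ({poly {poly rat}} * (nat * nat))%type.

Definition lcoef (f : lau) (i j : int) : rat :=
  let: (p, (a, b)) := f in
  let i' := (i + a%:Z)%R in let j' := (j + b%:Z)%R in
  if (0 <= i') && (0 <= j') then (p`_(absz j'))`_(absz i') else 0.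

Definition l0 : lau := (0, (0%N, 0%N)).
Definition lc (x : rat) : lau := (x%:P%:P, (0%N, 0%N)).
Definition lv : lau := (('X : {poly rat})%:P, (0%N, 0%N)).
Definition ly : lau := ('X, (0%N, 0%N)).
Definition lvinv : lau := (1, (1%N, 0%N)).
Definition lyinv : lau := (1, (0%N, 1%N)).

Definition ladd (f g : lau) : lau :=
  let: (p, (a, b)) := f in let: (q, (c, d)) := g in
  let a' := maxn a c in let b' := maxn b d in
  (p * ('X^(a' - a))%:P * 'X^(b' - b) + q * ('X^(a' - c))%:P * 'X^(b' - d),
   (a', b')).

Definition lmul (f g : lau) : lau :=
  let: (p, (a, b)) := f in let: (q, (c, d)) := g in (p * q, (a + c, b + d)%N).

Definition lpow (f : lau) (n : nat) : lau := iter n (lmul f) (lc 1).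

(* the operator (1/y) d/dy on Laurent polynomials:
   (1/y) d/dy (p y^-b) = (y p' - b p) y^(-b-2) *)
Definition lDy (f : lau) : lau :=
  let: (p, (a, b)) := f in ('X * p^`() - b%:R * p, (a, b.+2)).

(* Formal power series in c_0, c_1, ... with coefficients in lau.      *)
(* A monomial c^m is encoded by an exponent list s : seq nat with      *)
(* m a = nth 0 s a (trailing zeros allowed).  A series is the function *)
(* giving the coefficient of each monomial.                            *)
Definition ser := seq nat -> lau.

Definition mdeg (s : seq nat) : nat := sumn s.

Fixpoint divs (s : seq nat) : seq (seq nat) :=
  if s is e :: s' then [seq i :: t | i <- iota 0 e.+1, t <- divs s']
  else [:: [::]].

Definition msub (s t : seq nat) : seq nat := [seq (x.1 - x.2)%N | x <- zip s t].

Definition szero : ser := fun _ => l0.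
Definition sconst (x : lau) : ser := fun s => if mdeg s == 0%N then x else l0.
Definition sadd (F G : ser) : ser := fun s => ladd (F s) (G s).
Definition sscal (x : lau) (F : ser) : ser := fun s => lmul x (F s).
Definition smul (F G : ser) : ser :=
  fun s => \big[ladd/l0]_(t <- divs s) lmul (F t) (G (msub s t)).
Definition spow (F : ser) (n : nat) : ser := iter n (smul F) (sconst (lc 1)).
Definition sDy (F : ser) : ser := fun s => lDy (F s).

(* Sum of a family F with F r in the r-th power of the ideal (c_a)_a:
   the coefficient of a monomial of degree d only receives
   contributions from r <= d, so this is the (c-adically convergent)
   infinite sum \sum_{r >= 0} F r. *)
Definition ssum (F : nat -> ser) : ser :=
  fun s => \big[ladd/l0]_(r < (mdeg s).+1) F r s.

Definition cmon (a : nat) (s : seq nat) : bool :=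
  (mdeg s == 1%N) && (nth 0%N s a == 1%N).

Definition Pser (X : lau) : ser :=
  fun s => \big[ladd/l0]_(a < size s) (if cmon a s then lpow X a else l0).

Definition Aser : ser := sscal lvinv (Pser (lmul lv (lpow (ladd (lc 1) ly) 2))).

Definition Tser : ser :=
  sadd (sconst ly)
    (ssum (fun r => if r is r'.+1 then
                      sscal (lc (r`!%:R)^-1)
                        (iter r' sDy (sscal (ladd lyinv (lc 1)) (spow Aser r)))
                    else szero)).

(* ((T+y)/2) = y (1 + eps),  eps = (T - y)/(2y) *)
Definition epsser : ser :=
  sscal (lmul (lc (1/2)) lyinv) (sadd Tser (sconst (lmul (lc (-1)) ly))).

(* ((T+y)/2)^(-N) := y^-N (1+eps)^-N = y^-N \sum_k binom(-N,k) eps^k,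
   binom(-N,k) = (-1)^k C(N+k-1,k) *)
Definition Tnegpow (N : nat) : ser :=
  sscal (lpow lyinv N)
    (ssum (fun k => sscal (lc ((-1) ^+ k * ('C(N + k - 1, k))%:R)) (spow epsser k))).

(* Main.v *)
Require Import Defs.
From HB Require Import structures.
From mathcomp Require Import all_boot all_order all_algebra.
From mathcomp Require Import ring zify.
From mathcomp Require Import boolp.
Import Order.TTheory GRing.Theory Num.Theory.
Local Open Scope ring_scope.
Set Implicit Arguments. Unset Strict Implicit. Unset Printing Implicit Defensive.

(* With D = (1/y) d/dy, Lagrange inversion gives T = Y + (Y^2 - y^2)/2 where
   Y^2 = y^2 + 2 A(v, Y).  Hence, with X = 1 + Y and w = 1 - y,
   (T + y)/2 = (X^2 - w^2)/4 = (p - q)/(4v), where p = v X^2 and q = v w^2.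
   The coefficient wanted is thus, up to a factor, the residue in (v, y) of
   y (p - q)^-N dy dv.  Give every c_a the additional scaling c_a -> h c_a.
   Differentiating twice in h and integrating by parts turns that residue into
   those of the forms P(p)^(r+2) (p - q)^-k dp dq with k >= 2, which are exact
   because f(p) (p - q)^-k dp dq = d(f(p) (p - q)^(1-k) dp) / (1 - k), up to
   sign.  So only the part linear in the c_a survives, and it is explicit.

   To stay clear of Laurent polynomials, put C_a = c_a v^(a-1) y^-2: all series
   then live in Q[y][[C_0, C_1, ...]], and h d/dh, v d/dv, y d/dy become the
   derivations dh, dv, dy below. *)

(** * The ring of power series indexed by exponent lists *)

Section Convolution.
Variable R : comNzRingType.
Implicit Types f g h : seq nat -> R.

Definition conv f g (s : seq nat) : R :=
  \sum_(t <- divs s) f t * g (msub s t).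

Lemma conv_nil f g : conv f g [::] = f [::] * g [::].
Proof. by rewrite /conv /= big_seq1. Qed.

Lemma conv_cons f g e s :
  conv f g (e :: s) =
  \sum_(0 <= i < e.+1)
    conv (fun t => f (i :: t)) (fun t => g ((e - i)%N :: t)) s.
Proof.
rewrite /conv -[divs (e :: s)]/[seq i :: t | i <- iota 0 e.+1, t <- divs s].
by rewrite big_allpairs_dep /index_iota subn0.
Qed.

Lemma eq_conv f f' g g' s : f =1 f' -> g =1 g' -> conv f g s = conv f' g' s.
Proof. by move=> ff gg; apply: eq_bigr => t _; rewrite ff gg. Qed.

Lemma convC f g s : conv f g s = conv g f s.
Proof.
elim: s f g => [|e s IH] f g; first by rewrite !conv_nil mulrC.
rewrite !conv_cons big_nat_rev /=; apply: eq_big_nat => i /andP[_ lt_i].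
rewrite IH add0n subSS; apply: eq_conv => t //.
by rewrite subKn.
Qed.

Lemma conv_suml (I : Type) (r : seq I) (F : I -> seq nat -> R) g s :
  conv (fun t => \sum_(i <- r) F i t) g s = \sum_(i <- r) conv (F i) g s.
Proof.
rewrite /conv exchange_big /=; apply: eq_bigr => t _.
by rewrite big_distrl.
Qed.

Lemma conv_sumr (I : Type) (r : seq I) (F : I -> seq nat -> R) g s :
  conv g (fun t => \sum_(i <- r) F i t) s = \sum_(i <- r) conv g (F i) s.
Proof. by rewrite convC conv_suml; apply: eq_bigr => i _; rewrite convC. Qed.

(** Triples with total [e], grouped by the first entry or by the sum of the first two: associativity
    in one variable. *)
Lemma sum_triangle (F : nat -> nat -> nat -> R) e :
  \sum_(0 <= i < e.+1) \sum_(0 <= j < (e - i).+1) F i j (e - i - j)%N =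
  \sum_(0 <= i < e.+1) \sum_(0 <= j < i.+1) F j (i - j)%N (e - i)%N.
Proof.
have -> : \sum_(0 <= i < e.+1) \sum_(0 <= j < (e - i).+1) F i j (e - i - j)%N =
  \sum_(0 <= i < e.+1) \sum_(i <= k < e.+1) F i (k - i)%N (e - k)%N.
  apply: eq_big_nat => i /andP[_ lt_i].
  have := big_addn 0 e.+1 i xpredT (fun k => F i (k - i)%N (e - k)%N).
  rewrite add0n subSn // => ->.
  by apply: eq_bigr => j _; rewrite addnK addnC subnDA.
under eq_bigr => i _ do rewrite (big_nat_widenl _ 0) //= big_mkcond /=.
rewrite exchange_big_nat /=; apply: eq_big_nat => k /andP[_ lt_k].
by rewrite -big_mkcond [RHS](big_nat_widen _ _ e.+1).
Qed.

Lemma convA f g h s : conv f (conv g h) s = conv (conv f g) h s.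
Proof.
elim: s f g h => [|e s IH] f g h; first by rewrite !conv_nil mulrA.
rewrite !conv_cons.
pose F i j k := conv (fun t => f (i :: t))
  (conv (fun t => g (j :: t)) (fun t => h (k :: t))) s.
transitivity (\sum_(0 <= i < e.+1) \sum_(0 <= j < (e - i).+1)
    F i j (e - i - j)%N).
  apply: eq_bigr => i _; rewrite -conv_sumr.
  by apply: eq_conv => // t; rewrite conv_cons.
rewrite sum_triangle; apply: eq_bigr => i _.
under eq_bigr do rewrite /F IH.
by rewrite -conv_suml; apply: eq_conv => // t; rewrite conv_cons.
Qed.

Definition cst (x : R) (s : seq nat) : R := if mdeg s == 0%N then x else 0.

Lemma conv_cst x g s : conv (cst x) g s = x * g s.
Proof.
elim: s x g => [|e s IH] x g; first by rewrite conv_nil.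
rewrite conv_cons big_nat_recl // big1 ?addr0 => [|i _].
  rewrite (eq_conv _ (f' := cst x) (g' := fun t => g (e :: t))) ?IH // => t.
  by rewrite subn0.
rewrite (eq_conv _ (f' := cst 0) (g' := fun t => g ((e - i.+1)%N :: t))) //.
  by rewrite IH mul0r.
by move=> t; rewrite /cst /mdeg /= if_same.
Qed.

Lemma convDl f g h s : conv (fun t => f t + g t) h s = conv f h s + conv g h s.
Proof. by rewrite /conv -big_split; apply: eq_bigr => t _; rewrite mulrDl. Qed.

End Convolution.

(** The wrapper gives these functions convolution as product. Lists of different sizes never mix in
    [conv], so each size n carries its own copy of the series in n variables. *)
Record mser (R : Type) := MSer { mcoef : seq nat -> R }.

Section SeriesRing.
Variable R : comNzRingType.

HB.instance Definition _ := gen_eqMixin (mser R).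
HB.instance Definition _ := gen_choiceMixin (mser R).

Implicit Types f g h : mser R.

Lemma mserP f g : (forall s, mcoef f s = mcoef g s) -> f = g.
Proof. by case: f g => [f] [g] /= /funext ->. Qed.

Definition addS f g := MSer (fun s => mcoef f s + mcoef g s).
Definition oppS f := MSer (fun s => - mcoef f s).
Definition mulS f g := MSer (conv (mcoef f) (mcoef g)).
Definition cstS (x : R) := MSer (cst x).

Fact addSA : associative addS.
Proof. by move=> f g h; apply: mserP => s; apply: addrA. Qed.
Fact addSC : commutative addS.
Proof. by move=> f g; apply: mserP => s; apply: addrC. Qed.
Fact add0S : left_id (MSer (fun=> 0)) addS.
Proof. by move=> f; apply: mserP => s; apply: add0r. Qed.
Fact addNS : left_inverse (MSer (fun=> 0)) oppS addS.
Proof. by move=> f; apply: mserP => s; apply: addNr. Qed.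
HB.instance Definition _ := GRing.isZmodule.Build (mser R) addSA addSC add0S addNS.

Fact mulSA : associative mulS.
Proof. by move=> f g h; apply: mserP => s; apply: convA. Qed.
Fact mulSC : commutative mulS.
Proof. by move=> f g; apply: mserP => s; apply: convC. Qed.
Fact mul1S : left_id (cstS 1) mulS.
Proof. by move=> f; apply: mserP => s; rewrite /= conv_cst mul1r. Qed.
Fact mulSDl : left_distributive mulS addS.
Proof. by move=> f g h; apply: mserP => s; apply: convDl. Qed.
Fact oneS_neq0 : cstS 1 != 0 :> mser R.
Proof.
apply/eqP => /(congr1 (fun f => mcoef f [::])) /eqP.
by rewrite /= /cst eqxx oner_eq0.
Qed.
HB.instance Definition _ := GRing.Zmodule_isComNzRing.Build (mser R)
  mulSA mulSC mul1S mulSDl oneS_neq0.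

Lemma mcoef0 s : mcoef (0 : mser R) s = 0. Proof. by []. Qed.
Lemma mcoefD f g s : mcoef (f + g) s = mcoef f s + mcoef g s. Proof. by []. Qed.
Lemma mcoefN f s : mcoef (- f) s = - mcoef f s. Proof. by []. Qed.
Lemma mcoefB f g s : mcoef (f - g) s = mcoef f s - mcoef g s. Proof. by []. Qed.
Lemma mcoefM f g s : mcoef (f * g) s = conv (mcoef f) (mcoef g) s.
Proof. by []. Qed.
Lemma mcoef1 s : mcoef (1 : mser R) s = cst 1 s. Proof. by []. Qed.

Lemma mcoef_sum (I : Type) (r : seq I) (P : pred I) (F : I -> mser R) s :
  mcoef (\sum_(i <- r | P i) F i) s = \sum_(i <- r | P i) mcoef (F i) s.
Proof. exact: (big_morph (fun f => mcoef f s)). Qed.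

Fact cstS_is_additive : zmod_morphism cstS.
Proof.
move=> x y; apply: mserP => s; rewrite mcoefB /= /cst.
by case: ifP; rewrite ?subr0.
Qed.
Fact cstS_is_multiplicative : monoid_morphism cstS.
Proof.
split=> // x y; apply: mserP => s; rewrite mcoefM conv_cst /= /cst.
by case: ifP; rewrite ?mulr0.
Qed.
HB.instance Definition _ := GRing.isZmodMorphism.Build R (mser R) cstS
  cstS_is_additive.
HB.instance Definition _ := GRing.isMonoidMorphism.Build R (mser R) cstS
  cstS_is_multiplicative.

Lemma mcoef_cstM x f s : mcoef (cstS x * f) s = x * mcoef f s.
Proof. exact: conv_cst. Qed.

End SeriesRing.

(** * Derivations of a commutative ring *)

Definition derivation (R : comNzRingType) (d : R -> R) : Prop :=
  (forall f g, d (f + g) = d f + d g) /\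
  (forall f g, d (f * g) = d f * g + f * d g).

Section Derivation.
Variables (R : comNzRingType) (d : R -> R).
Hypothesis dP : derivation d.

Lemma derD f g : d (f + g) = d f + d g. Proof. exact: dP.1. Qed.
Lemma derM f g : d (f * g) = d f * g + f * d g. Proof. exact: dP.2. Qed.
Lemma der0 : d 0 = 0.
Proof. by apply: (addrI (d 0)); rewrite -derD !addr0. Qed.
Lemma derN f : d (- f) = - d f.
Proof. by apply/eqP; rewrite -addr_eq0 -derD addNr der0. Qed.
Lemma derB f g : d (f - g) = d f - d g. Proof. by rewrite derD derN. Qed.
Lemma der1 : d 1 = 0.
Proof. by apply: (addrI (d 1)); rewrite -{3}[1]mulr1 derM mulr1 mul1r addr0. Qed.
Lemma derMn f n : d (f *+ n) = d f *+ n.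
Proof. by elim: n => [|n IH]; rewrite ?mulr0n ?der0 // !mulrS derD IH. Qed.
Lemma der_nat n : d n%:R = 0. Proof. by rewrite derMn der1 mul0rn. Qed.

Lemma derX f n : d (f ^+ n.+1) = n.+1%:R * f ^+ n * d f.
Proof.
elim: n => [|n IH]; first by rewrite expr1 expr0 mul1r mul1r.
rewrite exprS derM IH exprS -(natr1 n.+1); ring.
Qed.

Lemma derVX f g n : f * g = 1 -> d (g ^+ n) = - (n%:R * g ^+ n.+1 * d f).
Proof.
move=> fg.
have dg : d g = - (g ^+ 2 * d f).
  have : g * d (f * g) = 0 by rewrite fg der1 mulr0.
  rewrite derM => h; have -> : d g = (f * g) * d g by rewrite fg mul1r.
  apply/eqP; rewrite -subr_eq0 -h; apply/eqP; ring.
case: n => [|n]; first by rewrite expr0 der1 !mul0r oppr0.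
by rewrite derX dg !exprS; ring.
Qed.

Lemma der_horner (P : {poly R}) x :
  d P.[x] = (map_poly d P).[x] + P^`().[x] * d x.
Proof.
elim/poly_ind: P => [|P c IH].
  by rewrite map_poly0 deriv0 !horner0 der0 mul0r addr0.
have -> : map_poly d (P * 'X + c%:P) = map_poly d P * 'X + (d c)%:P.
  apply/polyP => i; rewrite coef_map_id0 ?der0 // !(coefD, coefMX, coefC).
  rewrite coef_map_id0 ?der0 //.
  by case: (i == 0)%N; rewrite derD ?der0 ?add0r ?addr0.
rewrite !derivE !hornerE derD derM IH; ring.
Qed.

End Derivation.

(** * Identities on the curve Y^2 = y^2 + 2 A(Y) *)

Section Curve.
Variables (R : comNzRingType) (dh dv dy : R -> R).
Hypotheses (dhP : derivation dh) (dvP : derivation dv) (dyP : derivation dy).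
Hypothesis dhyC : forall f, dh (dy f) = dy (dh f).
Hypothesis dvyC : forall f, dv (dy f) = dy (dv f).
(* Rescaled dictionary: Y = y Z, A(v, Y) = y^2 B and dY/dy = kap.  The rules for
   P`_a reflect that it stands for C_a = c_a v^(a-1) y^-2. *)
Variables (y : R) (P : {poly R}) (X Z B B1 kap : R).
Hypotheses (dhy : dh y = 0) (dvy : dv y = 0) (dyy : dy y = y).
Hypotheses (dhPa : forall a, dh P`_a = P`_a)
           (dvPa : forall a, dv P`_a = P`_a *+ a - P`_a)
           (dyPa : forall a, dy P`_a = - (2 * P`_a)).
Hypotheses (XE : X = 1 + y * Z) (BE : B = P.[X ^+ 2]) (B1E : B1 = P^`().[X ^+ 2])
  (ZE : Z ^+ 2 = 1 + 2 * B).
Hypothesis kapE : kap = Z + dy Z.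
Hypothesis mul2I : injective (fun x : R => 2 * x).

Let derXE (d : R -> R) : derivation d -> d X = d y * Z + y * d Z.
Proof. by move=> dP; rewrite XE (derD dP) (der1 dP) add0r (derM dP). Qed.

Let derBE (d : R -> R) : derivation d ->
  d B = (map_poly d P).[X ^+ 2] + B1 * (2 * X * d X).
Proof. by move=> dP; rewrite BE (der_horner dP) (derX dP) expr1 B1E. Qed.

Let derZE (d : R -> R) : derivation d -> Z * d Z = d B.
Proof.
move=> dP; apply: mul2I => /=.
have : d (Z ^+ 2) = d (1 + 2 * B) by rewrite ZE.
rewrite (derX dP) (derD dP) (derM dP) (der1 dP) (der_nat dP 2) expr1 => h.
by rewrite mulrA h; ring.
Qed.

Let mapdh : (map_poly dh P).[X ^+ 2] = B.
Proof.
rewrite BE; congr (_.[_]); apply/polyP => a.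
by rewrite coef_map_id0 ?(der0 dhP).
Qed.

Let mapdy : (map_poly dy P).[X ^+ 2] = - (2 * B).
Proof.
rewrite BE -mulNr -hornerZ; congr (_.[_]); apply/polyP => a.
by rewrite coef_map_id0 ?(der0 dyP) // coefZ dyPa mulNr.
Qed.

Let mapdv : (map_poly dv P).[X ^+ 2] = X ^+ 2 * B1 - B.
Proof.
have -> : map_poly dv P = P^`() * 'X - P.
  apply/polyP => a; rewrite coef_map_id0 ?(der0 dvP) // dvPa coefB coefMX.
  by case: a => [|a] //=; rewrite coef_deriv.
by rewrite hornerD hornerN hornerMX BE B1E mulrC.
Qed.

(** Implicit differentiation of the curve in y, divided by y. The same factor multiplies dh Z and dv
    Z, so [kap] solves for both. *)
Let DK : (Z - 2 * X * y * B1) * kap = 1.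
Proof.
have h := derZE dyP; rewrite (derBE dyP) (derXE dyP) dyy mapdy in h.
by rewrite kapE; ring: h ZE.
Qed.

(** Unscaled, this is h dY/dh = y^-1 A(v, Y) dY/dy, the transport equation behind Lagrange
    inversion. *)
Lemma dhZ : dh Z = B * kap.
Proof.
have h := derZE dhP; rewrite (derBE dhP) (derXE dhP) dhy mapdh in h.
rewrite -[LHS]mulr1 -DK mulrA; congr (_ * _).
ring: h.
Qed.

Let dvZ : dv Z = kap * (X ^+ 2 * B1 - B).
Proof.
have h := derZE dvP; rewrite (derBE dvP) (derXE dvP) dvy mapdv in h.
rewrite -[LHS]mulr1 -DK mulrA [RHS]mulrC; congr (_ * _).
ring: h.
Qed.

Lemma dhX : dh X = y * (B * kap).
Proof. by rewrite (derXE dhP) dhy dhZ mul0r add0r. Qed.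

Lemma dyX : dy X = y * kap.
Proof. by rewrite (derXE dyP) dyy kapE; ring. Qed.

(** The left side is dp/dv for p = v X^2. Multiplying X^2 by [DK] brings out the factor kap; the
    curve equation does the rest. *)
Lemma dvXX : X ^+ 2 + dv (X ^+ 2) = X * kap * (Z + y).
Proof.
rewrite (derX dvP) expr1 (derXE dvP) dvy dvZ.
have k1 : kap * (Z - 2 * X * y * B1) = 1 by rewrite mulrC DK.
transitivity (X ^+ 2 * (kap * (Z - 2 * X * y * B1))
   + 2 * X * (y * (kap * (X ^+ 2 * B1 - B)))).
  by rewrite k1; ring.
by ring: XE ZE.
Qed.

Lemma dhB : dh B - B = B * dy B + 2 * B ^+ 2.
Proof. rewrite (derBE dhP) (derBE dyP) mapdh mapdy dhX dyX; ring. Qed.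

(** X kap is half of d(X^2)/dy, so it is transported in conservation form: the right side is d/dy of
    y X kap B. *)
Lemma dhpi : dh (X * kap) = X * kap * B + dy (X * kap * B).
Proof.
have dhk : dh kap = B * kap + dy (B * kap).
  by rewrite {1}kapE (derD dhP) dhyC dhZ.
rewrite (derM dhP) dhX dhk.
rewrite -!mulrA (derM dyP X) dyX [kap * B]mulrC; ring.
Qed.

(** Unscaled, h d/dh - (r+1) sends y^-1 X kap A(Y)^(r+1) to D (y^-1 X kap A(Y)^(r+2)): the inductive
    step of Lagrange inversion. *)
Lemma dh_pow r : dh (X * kap * B ^+ r.+1) - r.+1%:R * (X * kap * B ^+ r.+1) =
  dy (X * kap * B ^+ r.+2) + (r.+1.*2.+1)%:R * (X * kap * B ^+ r.+2).
Proof.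
have h : dh B = B + (B * dy B + 2 * B ^+ 2) by rewrite -dhB addrC subrK.
rewrite (derM dhP) (derX dhP) dhpi h !(derM dyP (X * kap)) (derX dyP).
have -> : (r.+1.*2.+1)%:R = 2 * r.+1%:R + 1 :> R by rewrite -addn1 -muln2 natrD natrM; ring.
rewrite -(natr1 r.+1) !exprS; ring.
Qed.

(** Z + y B stands for T / y. On the curve dh B = Z dh Z, so the left side is X dh Z. *)
Lemma dhG : dh (Z + y * B) = X * kap * B.
Proof.
rewrite (derD dhP) (derM dhP) dhy mul0r add0r -(derZE dhP) dhZ XE; ring.
Qed.

(* [falling r] is h^r (d/dh)^r.  D lowers the exponent of y by 2, so D^r, taking
   y^(2r+1) S to y S, acts by the factors dy + (2r+1), ..., dy + 3: this is
   [rising r]. *)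
Fixpoint falling r f :=
  if r is r'.+1 then dh (falling r' f) - r'%:R * falling r' f else f.

Fixpoint rising r f :=
  if r is r'.+1 then rising r' (dy f + (r'.*2.+3)%:R * f) else f.

Let rising_dh r k f :
  rising r (dh f - k%:R * f) = dh (rising r f) - k%:R * rising r f.
Proof.
elim: r f => [|r IH] f //=; rewrite -IH; congr (rising r _).
rewrite (derD dhP) (derM dhP) (der_nat dhP) dhyC (derB dyP) (derM dyP).
rewrite (der_nat dyP); ring.
Qed.

(** [dh_pow] is iterated, since dh commutes past [rising]. In degree r + 1 this will give the
    summand of index r + 1 in T. *)
Lemma falling_G r : falling r.+1 (Z + y * B) = rising r (X * kap * B ^+ r.+1).
Proof.
elim: r => [|r IH]; first by rewrite /= mul0r subr0 dhG.
by rewrite [LHS]/= -/(falling r.+1 _) IH -rising_dh dh_pow.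
Qed.

(** E stands for (T + y) / (2 y) = 1 + eps. *)
Variables (E Ei : R).
Hypotheses (EE : 2 * E = 1 + (Z + y * B)) (EiE : E * Ei = 1).

(* 4 y v E = p - q, d/dv p = Q, and dp dq = -2 v J dv dy. *)
Let w := 1 - y.
Let Q := X * kap * (Z + y).
Let J := w * (X * kap) * (Z + 1).

Let der2E (d : R -> R) : derivation d -> 2 * d E = d (Z + y * B).
Proof.
move=> dP; have := congr1 d EE.
by rewrite (derM dP) (der_nat dP 2) (derD dP 1) (der1 dP) mul0r !add0r.
Qed.

Lemma dhE : 2 * dh E = X * kap * B.
Proof. by rewrite (der2E dhP) dhG. Qed.

(** Half the y-derivative of 4 y E = X^2 - w^2. *)
Lemma dyE : 2 * (dy E + E) = X * kap + w.
Proof.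
rewrite mulrDr (der2E dyP) EE (derD dyP) (derM dyP) dyy -(derZE dyP) kapE XE /w.
by ring: ZE.
Qed.

(** The v-derivative of 4 y v E = p - q. *)
Lemma dvE : 4 * y * dv E = Q - w ^+ 2 - 4 * y * E.
Proof.
have -> : 4 * y * dv E = 2 * y * (2 * dv E) by ring.
rewrite (der2E dvP) (derD dvP) (derM dvP) dvy -(derZE dvP).
rewrite /Q -dvXX (derX dvP) expr1 (derXE dvP) dvy.
have -> : 4 * y * E = 2 * y * (2 * E) by ring.
by rewrite EE /w XE; ring: ZE.
Qed.

Lemma Z1E : Z + 1 = 2 * E - y * B.
Proof. rewrite EE; ring. Qed.

Let derEi (d : R -> R) n : derivation d ->
  d (Ei ^+ n) = - (n%:R * Ei ^+ n.+1 * d E).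
Proof. by move=> dP; apply: derVX. Qed.

(** Equality of the mixed second derivatives of p, as dp/dy = 2 v X kap. *)
Let dyQ : dy Q = 2 * y * (X * kap + dv (X * kap)).
Proof.
rewrite /Q -dvXX (derD dyP) -dvyC (derX dyP) expr1 dyX.
have -> : 2 * X * (y * kap) = y * (2 * (X * kap)) by ring.
by rewrite (derM dvP) dvy (derM dvP) (der_nat dvP 2); ring.
Qed.

(** v y^2 B = P(p) depends on p alone; this and [dvBE] are its derivatives in y and v. *)
Let dyBE : dy B = - (2 * B) + B1 * (2 * y * (X * kap)).
Proof. by rewrite (derBE dyP) mapdy dyX; ring. Qed.

Let dvBE : dv B = - B + B1 * Q.
Proof.
by rewrite (derBE dvP) mapdv /Q -dvXX (derX dvP) expr1; ring.
Qed.

Let dyy_pow r : dy (y ^+ r) = r%:R * y ^+ r.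
Proof.
case: r => [|r]; first by rewrite expr0 (der1 dyP) mul0r.
by rewrite (derX dyP) dyy -mulrA -exprSr.
Qed.

Let dvy_pow r : dv (y ^+ r) = 0.
Proof.
by case: r => [|r]; rewrite ?expr0 ?(der1 dvP) // (derX dvP) dvy mulr0.
Qed.

(* d(f(p) (p - q)^(1-k) dp) with f = P^(r+2) and k = m + r + 2. *)
Lemma exact_form r m (l := (m + r)%N.+1)
    (F := y ^+ r * B ^+ r.+2 * Ei ^+ l) :
  2 * (dy (F * Q) + 3 * (F * Q) - m%:R * (F * Q))
  - 4 * (dv (y * (F * (X * kap))) + 2 * (y * (F * (X * kap)))
         - m%:R * (y * (F * (X * kap))))
  = - (l%:R * (y ^+ r * B ^+ r.+2 * Ei ^+ l.+1 * J)).
Proof.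
have e1 : E * Ei ^+ l.+1 = Ei ^+ l by rewrite exprS mulrA EiE mul1r.
have dyF : dy F = r%:R * F - r.+2%:R * (2 * F)
    + r.+2%:R * (y ^+ r * B ^+ r.+1 * Ei ^+ l * B1 * (2 * y * (X * kap)))
    - l%:R * (y ^+ r * B ^+ r.+2 * Ei ^+ l.+1 * dy E).
  rewrite /F 2!(derM dyP) dyy_pow (derX dyP B) (derEi _ dyP) dyBE (exprS B r.+1).
  by ring.
have dvF : dv F = - (r.+2%:R * F)
    + r.+2%:R * (y ^+ r * B ^+ r.+1 * Ei ^+ l * B1 * Q)
    - l%:R * (y ^+ r * B ^+ r.+2 * Ei ^+ l.+1 * dv E).
  rewrite /F 2!(derM dvP) dvy_pow (derX dvP B) (derEi _ dvP) dvBE (exprS B r.+1).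
  by ring.
(* The [B1] terms will cancel because df(p) and dp are proportional, and [dyQ] removes the second
   derivatives of p. *)
rewrite (derM dyP F) dyQ (derM dvP y) dvy (derM dvP F) dyF dvF.
have -> : F = y ^+ r * B ^+ r.+2 * (E * Ei ^+ l.+1) by rewrite e1.
have h1 : 2 * dy E = X * kap + w - 2 * E by rewrite -dyE; ring.
have h2 := dvE.
have lE : l%:R = m%:R + r%:R + 1 :> R by rewrite /l -addn1 !natrD.
have r2 : r.+2%:R = r%:R + 2 :> R by rewrite -addn2 natrD.
rewrite mul0r add0r lE r2 /J /Q.
rewrite /Q in h2; rewrite /w in h1 h2 *.
(* The derivatives of E enter only as c (4 y dv E - (Z + y) 2 dy E), which [h1] and [h2]
   evaluate. *)
pose c := (m%:R + r%:R + 1) * (y ^+ r * B ^+ r.+2 * Ei ^+ l.+1) * (X * kap).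
have h0 : c * (4 * y * dv E) - c * (Z + y) * (2 * dy E) =
  c * (X * kap * (Z + y) - (1 - y) ^+ 2 - 4 * y * E)
  - c * (Z + y) * (X * kap + (1 - y) - 2 * E) by rewrite h1 h2.
apply/eqP; rewrite -subr_eq0; move/eqP: h0; rewrite -subr_eq0 => /eqP <-.
apply/eqP; rewrite /c; ring.
Qed.

(** [dh_pow] at r = 0 turns the factor X kap B into a y-derivative. After integration by parts the
    derivatives of Ei^m combine through 2 (B dy E - dh E) = B (w - 2 E), where X kap has
    cancelled. *)
Lemma second_order m :
  2 * (dh (X * kap * B * Ei ^+ m) - X * kap * B * Ei ^+ m) =
  2 * (dy (X * kap * B ^+ 2 * Ei ^+ m) + 3 * (X * kap * B ^+ 2 * Ei ^+ m)
       - m%:R * (X * kap * B ^+ 2 * Ei ^+ m))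
  + m%:R * (w * (X * kap) * B ^+ 2 * Ei ^+ m.+1).
Proof.
have h := dh_pow 0; rewrite expr1 mul1r /= in h.
have h' : dh (X * kap * B) = X * kap * B +
  (dy (X * kap * B ^+ 2) + 3 * (X * kap * B ^+ 2)) by rewrite -h; ring.
rewrite (derM dhP (X * kap * B)) (derM dyP (X * kap * B ^+ 2)) h'.
rewrite (derEi _ dhP) (derEi _ dyP).
have e1 : Ei ^+ m = E * Ei ^+ m.+1 by rewrite exprS mulrA EiE mul1r.
have h1 : 2 * dy E = X * kap + w - 2 * E by rewrite -dyE; ring.
pose c := m%:R * Ei ^+ m.+1 * (X * kap) * B.
have h0 : c * B * (2 * dy E) - c * (2 * dh E) =
  c * B * (X * kap + w - 2 * E) - c * (X * kap * B) by rewrite dhE h1.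
rewrite e1; apply/eqP; rewrite -subr_eq0; move/eqP: h0.
rewrite -subr_eq0 => /eqP <-; apply/eqP; rewrite /c; ring.
Qed.

Lemma dh_Ei n : 2 * dh (Ei ^+ n) = - (n%:R * (X * kap * B * Ei ^+ n.+1)).
Proof.
rewrite (derEi _ dhP).
have -> : 2 * - (n%:R * Ei ^+ n.+1 * dh E) = - (n%:R * Ei ^+ n.+1 * (2 * dh E)) by ring.
rewrite dhE; ring.
Qed.

(* [Om] is the coefficient of a monomial of y-weight m - 3 and v-weight m - 2,
   that is, a residue: it kills the total derivatives dy + (3 - m) and
   dv + (2 - m). *)
Variables (m K : nat) (Om : {additive R -> rat}).
Hypotheses (Om_dy : forall f, Om (dy f) = (m%:R - 3) * Om f)
           (Om_dv : forall f, Om (dv f) = (m%:R - 2) * Om f)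
           (OmK : forall f, Om (B ^+ K * f) = 0).

Let OmMn n f : Om (n%:R * f) = n%:R * Om f.
Proof. by rewrite mulr_natl raddfMn mulr_natl. Qed.

(** The residue of an exact form, divided by the nonzero integer l = m + r + 1. *)
Let Om_exact r : Om (y ^+ r * B ^+ r.+2 * Ei ^+ (m + r).+2 * J) = 0.
Proof.
have := congr1 Om (exact_form r m).
rewrite !(raddfB Om, raddfN Om, raddfD Om, OmMn, Om_dy, Om_dv) => h.
have l0 : (m + r).+1%:R != 0 :> rat by rewrite pnatr_eq0.
apply: (mulfI l0); rewrite mulr0; apply/eqP; rewrite -oppr_eq0 -h; apply/eqP.
ring.
Qed.

(** By [dh_Ei], this says that the second h-derivative of Ei^(m-1) has no residue. *)
Lemma Om_second_order : Om (dh (X * kap * B * Ei ^+ m) - X * kap * B * Ei ^+ m) = 0.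
Proof.
(* Since Z + 1 = 2 E - y B, the sequence [t] satisfies 2 t_r - t_(r+1) = exact:
   this expands 1 / (Z + 1) as a geometric series in y B / (2 E). *)
pose t r := w * (X * kap) * (y ^+ r * B ^+ r.+2 * Ei ^+ (m + r).+1).
have tS r : 2 * Om (t r) = Om (t r.+1).
  apply/eqP; rewrite -subr_eq0 -OmMn -raddfB -[X in _ == X](Om_exact r).
  apply/eqP; congr (Om _); rewrite /t /J Z1E addnS.
  have e1 : Ei ^+ (m + r).+1 = E * Ei ^+ (m + r).+2.
    by rewrite [in RHS]exprS mulrA EiE mul1r.
  rewrite e1 (exprS y) (exprS B r.+2); ring.
(* The residues of t form a geometric progression of ratio 2 that vanishes at index K, hence
   everywhere. *)
have t0 : Om (t 0%N) = 0.
  have tk r : Om (t r) = 2 ^+ r * Om (t 0%N).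
    by elim: r => [|r IH]; rewrite ?expr0 ?mul1r // -tS IH exprS mulrA.
  have : Om (t K) = 0.
    have -> : t K = B ^+ K * (w * (X * kap) * y ^+ K * B ^+ 2 * Ei ^+ (m + K).+1).
      by rewrite /t -addn2 exprD; ring.
    exact: OmK.
  by rewrite tk => /eqP; rewrite mulf_eq0 expf_eq0 andbF /= => /eqP.
have := congr1 Om (second_order m).
rewrite OmMn (raddfD Om (2 * _)) 2!OmMn (raddfB Om _ (m%:R * _)) (raddfD Om (dy _)).
rewrite !OmMn Om_dy.
have -> : w * (X * kap) * B ^+ 2 * Ei ^+ m.+1 = t 0%N.
  by rewrite /t expr0 addn0; ring.
rewrite t0 => h; apply: (mulfI (_ : 2 != 0)) => //.
by rewrite h; ring.
Qed.

End Curve.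

(** * Euler derivations and the degree filtration *)

Local Notation S := (mser {poly rat}).

(* [wt s] is \sum_a a * s_a. *)
Fixpoint wt (s : seq nat) : nat :=
  if s is _ :: s' then (mdeg s' + wt s')%N else 0%N.

Lemma divs_consP e s t : t \in divs (e :: s) ->
  exists i u, [/\ (i <= e)%N, u \in divs s & t = i :: u].
Proof.
case/allpairsPdep => i [u [hi hu ->]]; exists i, u; split=> //.
by move: hi; rewrite mem_iota add0n ltnS.
Qed.

Lemma mdeg_divs s t : t \in divs s -> (mdeg t + mdeg (msub s t))%N = mdeg s.
Proof.
elim: s t => [|e s IH] t; first by rewrite inE => /eqP ->.
move=> /divs_consP[i [u [hi /IH hu ->]]].
by rewrite /mdeg /msub /= in hu *; lia.
Qed.

Lemma wt_divs s t : t \in divs s -> (wt t + wt (msub s t))%N = wt s.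
Proof.
elim: s t => [|e s IH] t; first by rewrite inE => /eqP ->.
move=> /divs_consP[i [u [hi hu ->]]].
have := IH _ hu; have := mdeg_divs hu; rewrite -[msub (e :: s) (i :: u)]/((e - i)%N :: msub s u) /=; lia.
Qed.

Lemma size_divs s t : t \in divs s -> size t = size s /\ size (msub s t) = size s.
Proof.
elim: s t => [|e s IH] t; first by rewrite inE => /eqP ->.
by move=> /divs_consP[i [u [hi /IH[h1 h2] ->]]]; rewrite /= h1 h2.
Qed.

Lemma wt_mdeg0 s : mdeg s = 0%N -> wt s = 0%N.
Proof. by elim: s => //= e s IH; rewrite /mdeg /= in IH *; lia. Qed.

Lemma cmon_wt a s : cmon a s -> wt s = a.
Proof.
elim: s a => [|e s IH] [|a]; rewrite /cmon //= => /andP[/eqP hd /eqP hn].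
  rewrite /mdeg /= in hd; rewrite (wt_mdeg0 (s := s)) /mdeg; lia.
have hs : (nth 0 s a <= mdeg s)%N.
  rewrite /mdeg sumnE (big_nth 0%N) big_mkord.
  case: (ltnP a (size s)) => ha; last by rewrite nth_default.
  by rewrite (bigD1 (Ordinal ha)) //= leq_addr.
have ds : mdeg s = 1%N by rewrite /mdeg /= in hd hs *; lia.
by rewrite (IH a) /cmon ?ds ?hn.
Qed.

(** An Euler operator: b is the weight of y and c s the weight of C^s. *)
Definition wder (b : rat) (c : seq nat -> rat) (f : S) : S :=
  MSer (fun s => b *: ('X * (mcoef f s)^`()) + c s *: mcoef f s).

Lemma wder_derivation b c :
  (forall s t, t \in divs s -> c t + c (msub s t) = c s) ->
  derivation (wder b c).
Proof.
move=> cD; split=> f g; apply: mserP => s /=.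
  by rewrite derivD mulrDr !scalerDr addrACA.
rewrite /conv raddf_sum !(mulr_sumr, scaler_sumr) -!big_split /=.
rewrite !big_seq; apply: eq_bigr => t ht.
rewrite derivM -(cD _ _ ht) -!mul_polyC polyCD; ring.
Qed.

Lemma wder_comm b c b' c' f : wder b c (wder b' c' f) = wder b' c' (wder b c f).
Proof.
apply: mserP => s /=; rewrite !derivE -!mul_polyC; ring.
Qed.

(* C^s stands for c^s v^(wt s - mdeg s) y^(- 2 mdeg s). *)
Definition dh := wder 0 (fun s => (mdeg s)%:R).
Definition dv := wder 0 (fun s => (wt s)%:R - (mdeg s)%:R).
Definition dy := wder 1 (fun s => - (2 * (mdeg s)%:R)).

Lemma dh_derivation : derivation dh.
Proof. by apply: wder_derivation => s t /mdeg_divs <-; rewrite natrD. Qed.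

Lemma dv_derivation : derivation dv.
Proof.
apply: wder_derivation => s t ht; rewrite -(mdeg_divs ht) -(wt_divs ht) !natrD.
ring.
Qed.

Lemma dy_derivation : derivation dy.
Proof.
apply: wder_derivation => s t ht; rewrite -(mdeg_divs ht) natrD; ring.
Qed.

Lemma mcoef_dh f s : mcoef (dh f) s = (mdeg s)%:R *: mcoef f s.
Proof. by rewrite /= scale0r add0r. Qed.

Lemma mcoef_dv f s : mcoef (dv f) s = ((wt s)%:R - (mdeg s)%:R) *: mcoef f s.
Proof. by rewrite /= scale0r add0r. Qed.

Definition yS : S := cstS 'X.

Lemma dh_y : dh yS = 0.
Proof.
apply: mserP => s; rewrite mcoef_dh /= /cst.
by case: eqP => [->|_]; rewrite ?scale0r ?scaler0.
Qed.

Lemma dv_y : dv yS = 0.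
Proof.
apply: mserP => s; rewrite mcoef_dv /= /cst.
by case: eqP => [h|_]; rewrite ?scaler0 // (wt_mdeg0 h) h subrr scale0r.
Qed.

Lemma dy_y : dy yS = yS.
Proof.
apply: mserP => s; rewrite /= /cst; case: eqP => [->|_].
  by rewrite derivX mulr1 scale1r mulr0 oppr0 scale0r addr0.
by rewrite deriv0 mulr0 !scaler0 addr0.
Qed.

Definition gen (a : nat) : S := MSer (fun s => (cmon a s)%:R).

Lemma dh_gen a : dh (gen a) = gen a.
Proof.
apply: mserP => s; rewrite mcoef_dh /= /cmon.
by case: eqP => [->|_]; rewrite ?scale1r ?scaler0.
Qed.

Lemma dv_gen a : dv (gen a) = gen a *+ a - gen a.
Proof.
apply: mserP => s; rewrite mcoef_dv mcoefB -(mulr_natl (gen a)).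
rewrite -(rmorph_nat (@cstS _)) mcoef_cstM /=.
case h : (cmon a s); last by rewrite scaler0 mulr0 subr0.
have /andP[/eqP -> _] := h.
by rewrite (cmon_wt h) mulr1 scalerBl scale1r scaler_nat.
Qed.

Lemma dy_gen a : dy (gen a) = - (2 * gen a).
Proof.
apply: mserP => s; rewrite mcoefN -(rmorph_nat (@cstS _) 2) mcoef_cstM /=.
case h : (cmon a s); last first.
  by rewrite deriv0 !mulr0 !scaler0 addr0 oppr0.
have /andP[/eqP -> _] := h.
rewrite -[nat_of_bool true]/1%N mulr1n -polyC1 derivC mulr0 scaler0 add0r.
rewrite -mul_polyC; ring.
Qed.

Definition vord (k : nat) (f : S) : Prop :=
  forall s, (mdeg s < k)%N -> mcoef f s = 0.

Lemma vord0 f : vord 0 f. Proof. by move=> s. Qed.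

Lemma vord_leq j k f : (j <= k)%N -> vord k f -> vord j f.
Proof. by move=> jk hf s hs; apply: hf; apply: leq_trans jk. Qed.

Lemma vordD k f g : vord k f -> vord k g -> vord k (f + g).
Proof. by move=> hf hg s hs; rewrite mcoefD hf ?hg ?addr0. Qed.

Lemma vordN k f : vord k f -> vord k (- f).
Proof. by move=> hf s hs; rewrite mcoefN hf ?oppr0. Qed.

Lemma vordB k f g : vord k f -> vord k g -> vord k (f - g).
Proof. by move=> hf hg; apply/vordD/vordN. Qed.

Lemma vordM j k f g : vord j f -> vord k g -> vord (j + k) (f * g).
Proof.
move=> hf hg s hs; rewrite mcoefM /conv big_seq big1 // => t ht.
have := mdeg_divs ht; case: (ltnP (mdeg t) j) => [/hf -> _|hj]; first by rewrite mul0r.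
by move=> hd; rewrite hg ?mulr0 //; lia.
Qed.

Lemma vordMl k f g : vord k f -> vord k (g * f).
Proof. by move=> hf; have := vordM (@vord0 g) hf. Qed.

Lemma vordMr k f g : vord k f -> vord k (f * g).
Proof. by move=> hf; rewrite mulrC; apply: vordMl. Qed.

Lemma vordX k f n : vord k f -> vord (k * n) (f ^+ n).
Proof.
move=> hf; elim: n => [|n IH]; first by rewrite muln0; apply: vord0.
by rewrite exprS mulnS; apply: vordM.
Qed.

Lemma vord_sum k (I : Type) (r : seq I) (Q : pred I) (F : I -> S) :
  (forall i, Q i -> vord k (F i)) -> vord k (\sum_(i <- r | Q i) F i).
Proof.
by move=> hF; elim/big_ind: _ => // f g; apply: vordD.
Qed.

Lemma eq_vord k f g s : vord k (f - g) -> (mdeg s < k)%N -> mcoef f s = mcoef g s.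
Proof. by move=> h hs; apply/eqP; rewrite -subr_eq0 -mcoefB h. Qed.

Lemma vord_trans k f g h : vord k (f - g) -> vord k (g - h) -> vord k (f - h).
Proof. by move=> h1 h2; have := vordD h1 h2; rewrite addrA subrK. Qed.

(** * Solving equations degree by degree *)

Lemma fixpoint_exists (Phi : S -> S) :
  (forall f, vord 1 f -> vord 1 (Phi f)) ->
  (forall k f g, vord 1 f -> vord 1 g -> vord k (f - g) ->
     vord k.+1 (Phi f - Phi g)) ->
  exists f, vord 1 f /\ f = Phi f.
Proof.
move=> Phi1 contr; pose u k := iter k Phi 0.
have u1 k : vord 1 (u k) by elim: k => [|k IH] //=; apply: Phi1.
have uS k : vord k (u k.+1 - u k).
  by elim: k => [|k IH]; [apply: vord0 | exact: (contr _ _ _ (u1 k.+1) (u1 k))].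
have uk k j : vord k (u (j + k)%N - u k).
  elim: j => [|j IH]; first by rewrite add0n subrr.
  by apply: vord_trans IH; apply: vord_leq (uS _); rewrite leq_addl.
(* By [uk], coefficients of degree d are constant from the iterate d + 1 on. *)
pose f := MSer (fun s => mcoef (u (mdeg s).+1) s).
have fu k : vord k (f - u k).
  move=> s hs; rewrite mcoefB /=; apply/eqP; rewrite subr_eq0 eq_sym; apply/eqP.
  by rewrite -(subnK hs); apply: eq_vord (uk _ _) _.
have f1 : vord 1 f by have := vordD (fu 1%N) (u1 1%N); rewrite subrK.
exists f; split=> //; apply: mserP => s.
(* The iterate d + 1 is Phi of the iterate d, which agrees with f below degree d; contraction gives
   agreement in degree d. *)
rewrite -[LHS]/(mcoef (u (mdeg s).+1) s).
apply: (@eq_vord (mdeg s).+1) => //.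
by rewrite -opprB; apply: vordN; apply: contr.
Qed.

Lemma vord_wder k b c f : vord k f -> vord k (wder b c f).
Proof. by move=> hf s hs; rewrite /= hf // deriv0 mulr0 !scaler0 addr0. Qed.

Lemma vord_rising k r f : vord k f -> vord k (rising dy r f).
Proof.
elim: r f => [|r IH] f hf //=; apply: IH.
by apply: vordD; [apply: vord_wder | apply: vordMl].
Qed.

Lemma risingB r f g : rising dy r (f - g) = rising dy r f - rising dy r g.
Proof.
elim: r f g => [|r IH] f g //=; rewrite -IH; congr rising.
by rewrite (derB dy_derivation); ring.
Qed.

(** Serves to show that only the summand r = mdeg s of T reaches the monomial s. *)
Definition homog (r : nat) (f : S) : Prop :=
  forall s, mdeg s <> r -> mcoef f s = 0.

Lemma homogM j k f g : homog j f -> homog k g -> homog (j + k) (f * g).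
Proof.
move=> hf hg s hs; rewrite mcoefM /conv big_seq big1 // => t ht.
have := mdeg_divs ht; case: (eqVneq (mdeg t) j) => [-> hd | /eqP /hf -> _].
  by rewrite hg ?mulr0 // => hk; apply: hs; rewrite -hd hk.
by rewrite mul0r.
Qed.

Lemma homog_cst p : homog 0 (cstS p).
Proof. by move=> s /eqP hs; rewrite /= /cst (negbTE hs). Qed.

Lemma homogX k f n : homog k f -> homog (k * n) (f ^+ n).
Proof.
move=> hf; elim: n => [|n IH].
  by rewrite muln0 expr0 -(rmorph1 (@cstS _)); apply: homog_cst.
by rewrite exprS mulnS; apply: homogM.
Qed.

Lemma homog_rising k r f : homog k f -> homog k (rising dy r f).
Proof.
elim: r f => [|r IH] f hf //=; apply: IH => s hs.
rewrite mcoefD -(rmorph_nat (@cstS _)) mcoef_cstM /= hf //.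
by rewrite deriv0 !mulr0 !scaler0 !addr0.
Qed.

Lemma homog_gen a : homog 1 (gen a).
Proof. by move=> s /eqP hs; rewrite /= /cmon (negbTE hs). Qed.

Lemma vord_gen a : vord 1 (gen a).
Proof. by move=> s hs; apply: homog_gen => h; rewrite h in hs. Qed.

(* Exponent lists of size n only involve c_0, ..., c_(n-1), so the truncation of P
   at n is harmless on them. *)
Definition pgen (n : nat) : {poly S} := \poly_(a < n) gen a.

Lemma vord_pgen n x : vord 1 (pgen n).[x].
Proof.
by rewrite horner_poly; apply: vord_sum => i _; apply: vordMr; apply: vord_gen.
Qed.

Lemma vord_pgenB n k a b :
  vord k (a - b) -> vord k.+1 ((pgen n).[a] - (pgen n).[b]).
Proof.
move=> hab; rewrite !horner_poly -sumrB; apply: vord_sum => i _.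
rewrite -mulrBr -add1n; apply: vordM; first exact: vord_gen.
by rewrite subrXX; apply: vordMr.
Qed.

Definition halfS : S := cstS (1 / 2)%:P.

Lemma halfS2 : 2 * halfS = 1.
Proof.
rewrite -(rmorph_nat (@cstS _)) -rmorphM -(rmorph_nat (@polyC _)) -rmorphM /=.
by rewrite -(rmorph1 (@cstS _)).
Qed.

Lemma mulS2I : injective (fun x : S => 2 * x).
Proof.
move=> a b /(congr1 (fun x => halfS * x)) /=.
by rewrite !mulrA [halfS * 2]mulrC halfS2 !mul1r.
Qed.

(** With Z = 1 + z the equation becomes z = P(X^2) - z^2 / 2, a contraction on series z without
    constant term. *)
Lemma curve_exists n : exists Z : S,
  vord 1 (Z - 1) /\ Z ^+ 2 = 1 + 2 * (pgen n).[(1 + yS * Z) ^+ 2].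
Proof.
pose Phi z := (pgen n).[(1 + yS * (1 + z)) ^+ 2] - halfS * z ^+ 2.
have [f|k f g f1 g1 fg|z [z1 zE]] := @fixpoint_exists Phi.
- move=> f1; apply: vordB; first exact: vord_pgen.
  by rewrite expr2 mulrA; apply: vordMl.
- have -> : Phi f - Phi g =
    ((pgen n).[(1 + yS * (1 + f)) ^+ 2] - (pgen n).[(1 + yS * (1 + g)) ^+ 2])
    - halfS * ((f + g) * (f - g)) by rewrite /Phi; ring.
  apply: vordB; last by apply: vordMl; rewrite -add1n; apply/vordM/fg/vordD.
  by apply: vord_pgenB; rewrite subr_sqr opprD addrACA subrr add0r -mulrBr
    opprD addrACA subrr add0r; apply/vordMr/vordMl.
exists (1 + z); split; first by rewrite addrAC subrr add0r.
have -> : (1 + z) ^+ 2 = 1 + 2 * z + (2 * halfS) * z ^+ 2 by rewrite halfS2; ring.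
by rewrite {1}zE /Phi; ring.
Qed.

Lemma inv_exists (e : S) : vord 1 e -> exists f, (1 + e) * f = 1.
Proof.
move=> e1.
have [f|k f g f1 g1 fg|z [z1 zE]] := @fixpoint_exists (fun f => - e * (1 + f)).
- by move=> f1; apply: vordMr; apply: vordN.
- have -> : - e * (1 + f) - - e * (1 + g) = - e * (f - g) by ring.
  by rewrite -add1n; apply/vordM/fg/vordN.
exists (1 + z).
have -> : (1 + e) * (1 + z) = 1 + z - - e * (1 + z) by ring.
by rewrite -zE addrK.
Qed.

(** The number binom(-N, k) as a constant series; the truncated subtraction still gives 1 at N = k =
    0. *)
Definition nbc (N k : nat) : S := cstS ((-1) ^+ k * 'C(N + k - 1, k)%:R)%:P.

(* The binomial series of (1 + e)^-N, truncated at degree K. *)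
Definition nb (N K : nat) (e : S) : S := \sum_(k < K) nbc N k * e ^+ k.

Lemma nbc0 N : nbc N 0 = 1.
Proof. by rewrite /nbc bin0 mulr1 expr0 polyC1 rmorph1. Qed.

(** Pascal's rule for the upper index -N. *)
Lemma nbcS N k : nbc N.+1 k.+1 + nbc N.+1 k = nbc N k.+1.
Proof.
rewrite /nbc -rmorphD -polyCD; congr (cstS _%:P).
rewrite !addSn !addnS !subn1 /= binS natrD exprS; ring.
Qed.

Lemma nbS N K e :
  (1 + e) * nb N.+1 K.+1 e = nb N K.+1 e + nbc N.+1 K * e ^+ K.+1.
Proof.
rewrite /nb; elim: K => [|K IH].
  by rewrite !big_ord1 !nbc0; ring.
rewrite big_ord_recr /= mulrDr IH [in RHS]big_ord_recr /= -(nbcS N K) !exprS.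
ring.
Qed.

(** Induction on N: by [nbS], multiplying by 1 + e lowers N up to a tail of order beyond the
    truncation. *)
Lemma nbE N K e f : vord 1 e -> (1 + e) * f = 1 -> vord K (f ^+ N - nb N K e).
Proof.
move=> e1 ef.
have eK : vord K (e ^+ K) by have := @vordX 1 e K e1; rewrite mul1n.
elim: N => [|N IH].
  case: K {eK} => [|K]; first exact: vord0.
  (* At N = 0 only k = 0 survives, since 'C(k - 1, k) = 0 for k > 0. *)
  rewrite /nb big_ord_recl big1 => [|i _]; last first.
    by rewrite /nbc /bump /= add0n subn1 /= bin_small // mulr0 polyC0 rmorph0 mul0r.
  by rewrite !expr0 nbc0 mulr1 addr0 subrr => s.
case: K {IH}eK (IH) => [|K] eK {}IH; first exact: vord0.
have -> : f ^+ N.+1 - nb N.+1 K.+1 e =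
  f * (f ^+ N - (1 + e) * nb N.+1 K.+1 e).
  by rewrite mulrBr mulrA [f * (1 + e)]mulrC ef mul1r exprS.
rewrite nbS opprD addrA; apply/vordMl/vordB => //; exact: vordMl.
Qed.

(** * Coefficients of the solution *)

Definition scoef (s : seq nat) (j : nat) (f : S) : rat := (mcoef f s)`_j.

Fact scoef_is_additive s j : zmod_morphism (scoef s j).
Proof. by move=> f g; rewrite /scoef mcoefB coefB. Qed.
HB.instance Definition _ s j := GRing.isZmodMorphism.Build S rat (scoef s j)
  (scoef_is_additive s j).

Lemma scoef_dh s j f : scoef s j (dh f) = (mdeg s)%:R * scoef s j f.
Proof. by rewrite /scoef mcoef_dh coefZ. Qed.

Lemma scoef_dv s j f : scoef s j (dv f) = ((wt s)%:R - (mdeg s)%:R) * scoef s j f.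
Proof. by rewrite /scoef mcoef_dv coefZ. Qed.

Lemma scoef_dy s j f : scoef s j (dy f) = (j%:R - 2 * (mdeg s)%:R) * scoef s j f.
Proof.
rewrite /scoef /= coefD !coefZ coefXM mul1r mulrBl mulNr coef_deriv.
case: j => [|j] /=; first by rewrite mul0r.
by rewrite -[_ *+ j.+1]mulr_natl.
Qed.

Lemma scoef_vord k s j f : vord k f -> (mdeg s < k)%N -> scoef s j f = 0.
Proof. by move=> hf hs; rewrite /scoef hf ?coef0. Qed.

Lemma scoefMn s j k f : scoef s j (k%:R * f) = k%:R * scoef s j f.
Proof. by rewrite mulr_natl raddfMn mulr_natl. Qed.

Lemma scoef_falling s j r f :
  scoef s j (falling dh r f) = (mdeg s ^_ r)%:R * scoef s j f.
Proof.
elim: r => [|r IH]; first by rewrite mul1r.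
rewrite /= raddfB /= scoef_dh scoefMn IH ffactnSr natrM.
case: (leqP r (mdeg s)) => hr; first by rewrite natrB //; ring.
by rewrite ffact_small // !mul0r !mulr0 subrr.
Qed.

Lemma coef_1DXn (R : nzRingType) n k : (((1 + 'X) ^+ n : {poly R})`_k) = 'C(n, k)%:R.
Proof.
elim: n k => [|n IH] k; first by rewrite expr0 coef1 bin0n; case: k.
rewrite exprS mulrDl mul1r coefD coefXM IH.
by case: k => [|k]; rewrite ?addr0 ?bin0 //= IH binS natrD.
Qed.

Lemma mdeg1_cmon s : mdeg s = 1%N -> cmon (wt s) s.
Proof.
elim: s => // e s IH; rewrite /mdeg /= -/(mdeg s) => h.
case: e h => [|[|e]] h; last by lia.
  have ds : mdeg s = 1%N by lia.
  have /andP[_ h1] := IH ds.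
  by rewrite /cmon ds add1n /= h1 andbT /mdeg /= -/(mdeg s) ds.
have ds : mdeg s = 0%N by lia.
by rewrite /cmon (wt_mdeg0 ds) ds /mdeg /= -/(mdeg s) ds.
Qed.

Lemma mulr_diff (R : comNzRingType) (a b c d : R) :
  a * b - c * d = a * (b - d) + (a - c) * d.
Proof. ring. Qed.

Section Instance.
Variables (n : nat) (Z X B kap A : S).
Hypotheses (XE : X = 1 + yS * Z) (BE : B = (pgen n).[X ^+ 2])
  (kapE : kap = Z + dy Z) (AE : A = (pgen n).[(1 + yS) ^+ 2])
  (Z1 : vord 1 (Z - 1)) (ZE : Z ^+ 2 = 1 + 2 * B).

Let B1 : vord 1 B. Proof. by rewrite BE; apply: vord_pgen. Qed.
Let A1 : vord 1 A. Proof. by rewrite AE; apply: vord_pgen. Qed.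
Let vordX1 f r : vord 1 f -> vord r (f ^+ r).
Proof. by move=> f1; have := @vordX 1 f r f1; rewrite mul1n. Qed.

Let dhPa a : dh (pgen n)`_a = (pgen n)`_a.
Proof. by rewrite coef_poly; case: ifP => _; rewrite ?dh_gen ?(der0 dh_derivation). Qed.

Let dvPa a : dv (pgen n)`_a = (pgen n)`_a *+ a - (pgen n)`_a.
Proof.
rewrite coef_poly; case: ifP => _; rewrite ?dv_gen // (der0 dv_derivation).
by rewrite mul0rn subrr.
Qed.

Let dyPa a : dy (pgen n)`_a = - (2 * (pgen n)`_a).
Proof.
rewrite coef_poly; case: ifP => _; rewrite ?dy_gen // (der0 dy_derivation).
by rewrite mulr0 oppr0.
Qed.

Let dhyC f : dh (dy f) = dy (dh f). Proof. exact: wder_comm. Qed.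
Let dvyC f : dv (dy f) = dy (dv f). Proof. exact: wder_comm. Qed.

(** To lowest order the curve is Y = y. From here to [pi1], X, kap and B are replaced by 1 + y, 1
    and A up to higher order. *)
Let X1 : vord 1 (X - (1 + yS)).
Proof.
have -> : X - (1 + yS) = yS * (Z - 1) by rewrite XE; ring.
exact: vordMl.
Qed.

Let kap1 : vord 1 (kap - 1).
Proof.
have -> : kap - 1 = (Z - 1) + dy (Z - 1).
  by rewrite (derB dy_derivation) (der1 dy_derivation) kapE; ring.
by apply/vordD/vord_wder.
Qed.

Let BA : vord 2 (B - A).
Proof.
by rewrite BE AE; apply: vord_pgenB; rewrite subr_sqr; apply: vordMr.
Qed.

Let BAX r : vord r.+1 (B ^+ r - A ^+ r).
Proof.
elim: r => [|r IH]; first by rewrite !expr0 subrr => s.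
rewrite !exprS mulr_diff; apply: vordD; first by rewrite -(add1n r.+1); apply: vordM.
by rewrite -(add2n r); apply: vordM => //; apply: vordX1.
Qed.

Let pi1 : vord 1 (X * kap - (1 + yS)).
Proof.
rewrite -[1 + yS in X in vord _ X]mulr1 mulr_diff mulr1.
by apply: vordD => //; apply: vordMl.
Qed.

(** In degree r + 1, [falling] multiplies by (r+1)!, while the right side of [falling_G] starts in
    that degree and reduces to its leading term. *)
Lemma lagrange_coef r s : mdeg s = r.+1 ->
  mcoef (Z + yS * B) s =
  (r.+1)`!%:R^-1 *: mcoef (rising dy r ((1 + yS) * A ^+ r.+1)) s.
Proof.
move=> hs; have f0 : (r.+1)`!%:R != 0 :> rat by rewrite pnatr_eq0 -lt0n fact_gt0.
have FG : falling dh r.+1 (Z + yS * B) = rising dy r (X * kap * B ^+ r.+1).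
  apply: (falling_G dh_derivation dy_derivation dhyC dh_y dy_y dhPa dyPa XE BE
    erefl ZE kapE).
  exact: mulS2I.
have h : vord r.+2 (X * kap * B ^+ r.+1 - (1 + yS) * A ^+ r.+1).
  rewrite mulr_diff; apply: vordD; first exact: vordMl.
  by rewrite -(add1n r.+1); apply: vordM => //; apply: vordX1.
have {h} := vord_rising r h; rewrite risingB => h.
rewrite -(eq_vord h) ?hs // -FG; apply/polyP => j; rewrite coefZ.
have := scoef_falling s j r.+1 (Z + yS * B); rewrite /scoef hs ffactnn => ->.
by rewrite mulKf.
Qed.

Lemma mcoefG0 s : mdeg s = 0%N -> mcoef (Z + yS * B) s = 1.
Proof.
move=> hs; have h : vord 1 (Z + yS * B - 1).
  by rewrite addrAC; apply/vordD/vordMl.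
by rewrite (eq_vord h) ?hs // mcoef1 /cst hs.
Qed.

Variables (E Ei : S).
Hypotheses (EE : 2 * E = 1 + (Z + yS * B)) (EiE : E * Ei = 1).

Let dhEi N : 2 * dh (Ei ^+ N) = - (N%:R * (X * kap * B * Ei ^+ N.+1)).
Proof.
apply: (dh_Ei dh_derivation dy_derivation dh_y dy_y dhPa dyPa
  XE BE erefl ZE kapE mulS2I EE EiE).
Qed.

(** The monomial has v-weight N and y-weight N - 1, so it is a residue for m = N + 2.
    [Om_second_order] gives a factor mdeg s - 1, and [dh_Ei] a factor mdeg s, both nonzero. *)
Lemma scoef_Ei_ge2 N s j : (1 < mdeg s)%N -> wt s = (N + mdeg s)%N ->
  (j = 2 * mdeg s + N - 1)%N -> scoef s j (Ei ^+ N.+1) = 0.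
Proof.
move=> hd hw hj.
have Omd (f : S) : scoef s j (dy f) = (N.+2%:R - 3) * scoef s j f.
  rewrite scoef_dy; congr (_ * _).
  have -> : j%:R = 2 * (mdeg s)%:R + N%:R - 1 :> rat.
    have h1 : (1 <= 2 * mdeg s + N)%N by lia.
    by rewrite hj natrB // natrD natrM.
  by rewrite -addn2 natrD; ring.
have Omv (f : S) : scoef s j (dv f) = (N.+2%:R - 2) * scoef s j f.
  by rewrite scoef_dv hw natrD -addn2 natrD; congr (_ * _); ring.
have OmK (f : S) : scoef s j (B ^+ (mdeg s).+1 * f) = 0.
  apply: (@scoef_vord (mdeg s).+1) => //; apply: vordMr.
  exact: vordX1.
have := Om_second_order dh_derivation dv_derivation dy_derivation dhyC dvyC
  dh_y dv_y dy_y dhPa dvPa dyPa XE BE erefl ZE kapE mulS2I EE EiE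
  Omd Omv OmK.
rewrite raddfB /= scoef_dh => h.
have x0 : scoef s j (X * kap * B * Ei ^+ N.+2) = 0.
  have d1 : (mdeg s)%:R - 1 != 0 :> rat by rewrite subr_eq0 pnatr_eq1; lia.
  by apply: (mulfI d1); rewrite mulr0 -h; ring.
have := congr1 (scoef s j) (dhEi N.+1).
rewrite raddfN /= !scoefMn x0 mulr0 oppr0 scoef_dh => /eqP.
rewrite !mulf_eq0 !pnatr_eq0 /= => /orP[/eqP h0|/eqP //].
by rewrite h0 in hd.
Qed.

Lemma mcoef_linear a s : cmon a s -> size s = n ->
  mcoef ((1 + yS) * A) s = (1 + 'X) ^+ (2 * a).+1.
Proof.
move=> ha hn; have an : (a < n)%N.
  rewrite -hn ltnNge; apply/negP => hs.
  by move/andP: ha => [_]; rewrite nth_default.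
have yE : 1 + yS = cstS (1 + 'X) by rewrite rmorphD rmorph1.
rewrite yE mcoef_cstM AE horner_poly mcoef_sum yE [RHS]exprS; congr (_ * _).
rewrite (bigD1 (Ordinal an)) // big1 => [|i neq].
  by rewrite [LHS]addr0 -!rmorphXn mulrC mcoef_cstM [mcoef _ _]/= ha mulr1 exprM.
rewrite -!rmorphXn mulrC mcoef_cstM /=.
case hi : (cmon i s); last by rewrite mulr0.
case/negP: neq; apply/eqP/val_inj => /=.
by rewrite -(cmon_wt ha) (cmon_wt hi).
Qed.

(** In degree 1, [dh_Ei] gives twice the coefficient as -(N+1) [y^(N+1)] (1+y)^(2N+3). *)
Lemma scoef_Ei_1 N s : cmon N.+1 s -> size s = n ->
  scoef s N.+1 (Ei ^+ N.+1) =
  - (1 / 4) * N.+1%:R * 'C(2 * N.+1 + 2, N.+1 + 1)%:R.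
Proof.
move=> hs hn; have /andP[/eqP d1 _] := hs.
have Ei1 : vord 1 (Ei - 1).
  have -> : Ei - 1 = - Ei * (E - 1) by rewrite mulrBr mulNr mulrC EiE; ring.
  apply: vordMl; have -> : E - 1 = halfS * (2 * E - 2).
    transitivity (2 * halfS * (E - 1)); first by rewrite halfS2 mul1r.
    ring.
  have -> : 2 * E - 2 = (Z - 1) + yS * B by rewrite EE; ring.
  by apply/vordMl/vordD/vordMl.
have EX k : vord 1 (Ei ^+ k - 1).
  by rewrite subrX1; apply: vordMr.
have h : vord 2 (X * kap * B * Ei ^+ N.+2 - (1 + yS) * A).
  rewrite -[X * kap * B * _]mulrA mulr_diff -[A in _ - A]mulr1 mulr_diff mulr1.
  apply: vordD; last exact: (@vordM 1 1).
  by apply/vordMl/vordD => //; apply: (@vordM 1 1).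
have := congr1 (scoef s N.+1) (dhEi N.+1).
have d1' : (mdeg s)%:R = 1 :> rat by rewrite d1.
rewrite raddfN /= !scoefMn scoef_dh d1' mul1r.
rewrite [scoef s _ (X * _ * _ * _)]/scoef (eq_vord h) ?d1 // (mcoef_linear hs hn).
rewrite coef_1DXn => h2; apply: (mulfI (_ : 2 != 0)) => //; rewrite h2.
(* A central binomial coefficient is the sum of two equal neighbours in the row above. *)
have -> : 'C(2 * N.+1 + 2, N.+1 + 1) = (2 * 'C((2 * N.+1).+1, N.+1))%N.
  rewrite addn2 addn1 binS [RHS]mulSn mul1n; congr (_ + _)%N.
  by rewrite -bin_sub; [congr 'C(_, _); lia | lia].
by rewrite natrM; field.
Qed.

Lemma scoef_Ei N s j : size s = n -> wt s = (N + mdeg s)%N ->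
  (j.+1 = 2 * mdeg s + N)%N ->
  scoef s j (Ei ^+ N.+1) =
  if cmon N.+1 s then - (1 / 4) * N.+1%:R * 'C(2 * N.+1 + 2, N.+1 + 1)%:R else 0.
Proof.
move=> hn hw hj; case: ifP => hs.
  have /andP[/eqP d1 _] := hs.
  have -> : j = N.+1 by lia.
  exact: scoef_Ei_1.
apply: scoef_Ei_ge2 => //; last by lia.
rewrite ltnNge; apply/negP => d1; move/negP: hs; apply.
(* Degree 0 would force N = 0 and then j + 1 = 0. *)
case: (posnP (mdeg s)) => d0; first by have := wt_mdeg0 d0; lia.
have {d0}d1 : mdeg s = 1%N by lia.
by have := mdeg1_cmon d1; rewrite hw d1 addn1.
Qed.

End Instance.

(** * From Laurent polynomials to rescaled coefficients *)

Local Notation PP := {poly {poly rat}}.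
Local Notation vP := (('X : {poly rat})%:P : PP).

Section Laurent.
Variables (KF : fieldType) (tau : {rmorphism PP -> KF}).
Hypothesis tau_inj : injective tau.

Definition vF : KF := tau vP.
Definition yF : KF := tau 'X.
Definition iota_y (p : {poly rat}) : KF := tau (map_poly polyC p).

(** Evaluating in a field, where v and y are invertible, identifies all representations of one
    Laurent polynomial. *)
Definition ev (f : lau) : KF :=
  let: (p, (a, b)) := f in tau p / (vF ^+ a * yF ^+ b).

Lemma vF_neq0 : vF != 0.
Proof. by rewrite -(rmorph0 tau) (inj_eq tau_inj) polyC_eq0 polyX_eq0. Qed.

Lemma yF_neq0 : yF != 0.
Proof. by rewrite -(rmorph0 tau) (inj_eq tau_inj) polyX_eq0. Qed.

Lemma iotaD p q : iota_y (p + q) = iota_y p + iota_y q.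
Proof. by rewrite /iota_y !rmorphD. Qed.

Lemma iotaM p q : iota_y (p * q) = iota_y p * iota_y q.
Proof. by rewrite /iota_y !rmorphM. Qed.

Lemma iota0 : iota_y 0 = 0.
Proof. by rewrite /iota_y !rmorph0. Qed.

Lemma iota1 : iota_y 1 = 1.
Proof. by rewrite /iota_y !rmorph1. Qed.

Lemma ev_l0 : ev l0 = 0.
Proof. by rewrite /ev /l0 rmorph0 mul0r. Qed.

Lemma ev_ladd f g : ev (ladd f g) = ev f + ev g.
Proof.
case: f g => [p [a b]] [q [c d]]; rewrite /ev /ladd.
rewrite rmorphD !rmorphM rmorphXn !polyC_exp !rmorphXn -/vF -/yF.
have h (x : KF) k m : x != 0 -> (k <= m)%N -> x ^+ m = x ^+ (m - k) * x ^+ k.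
  by move=> _ km; rewrite -exprD subnK.
have v0 := vF_neq0; have y0 := yF_neq0.
have hv1 := h _ _ _ v0 (leq_maxl a c); have hv2 := h _ _ _ v0 (leq_maxr a c).
have hy1 := h _ _ _ y0 (leq_maxl b d); have hy2 := h _ _ _ y0 (leq_maxr b d).
rewrite mulrDl {1}hv1 {1}hy1 hv2 hy2.
by congr (_ + _); field; rewrite ?expf_neq0.
Qed.

Lemma ev_lmul f g : ev (lmul f g) = ev f * ev g.
Proof.
case: f g => [p [a b]] [q [c d]]; rewrite /ev /lmul rmorphM !exprD.
by field; rewrite ?expf_neq0 ?vF_neq0 ?yF_neq0.
Qed.

(* f is the Laurent polynomial v^i y^j p(y). *)
Definition rep (i j : int) (f : lau) (p : {poly rat}) : Prop :=
  ev f = vF ^ i * yF ^ j * iota_y p.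

Lemma rep0 i j : rep i j l0 0.
Proof. by rewrite /rep ev_l0 iota0 mulr0. Qed.

Lemma repD i j f g p q : rep i j f p -> rep i j g q -> rep i j (ladd f g) (p + q).
Proof. by rewrite /rep ev_ladd iotaD mulrDr => -> ->. Qed.

Lemma repM i j i' j' f g p q :
  rep i j f p -> rep i' j' g q -> rep (i + i') (j + j') (lmul f g) (p * q).
Proof.
rewrite /rep ev_lmul iotaM => -> ->.
by rewrite !expfzDr ?vF_neq0 ?yF_neq0 //; ring.
Qed.

Lemma rep_lc x : rep 0 0 (lc x) x%:P.
Proof.
rewrite /rep /ev /lc /iota_y /= !expr0 !expr0z !mul1r invr1 mulr1.
by rewrite map_polyC.
Qed.

Lemma rep1 : rep 0 0 (lc 1) 1. Proof. exact: rep_lc. Qed.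

Lemma repX i j f p k : rep i j f p -> rep (i *+ k) (j *+ k) (lpow f k) (p ^+ k).
Proof.
move=> h; elim: k => [|k IH]; first by rewrite !mulr0n; apply: rep1.
by rewrite !mulrS exprS; apply: repM.
Qed.

Lemma rep_lv : rep 1 0 lv 1.
Proof. by rewrite /rep /= iota1 -?/vF -?/yF !expr0 expr1z expr0z !mulr1 divr1. Qed.

Lemma rep_lvinv : rep (-1) 0 lvinv 1.
Proof. by rewrite /rep /= rmorph1 iota1 expr0 expr1 expr0z !mulr1 div1r. Qed.

Lemma rep_ly : rep 0 1 ly 1.
Proof. by rewrite /rep /= iota1 -?/vF -?/yF !expr0 expr1z expr0z !mulr1 divr1 mul1r. Qed.

Lemma rep_ly' : rep 0 0 ly 'X.
Proof.
by rewrite /rep /= /iota_y map_polyX !expr0 !expr0z !mulr1 divr1 !mul1r.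
Qed.

Lemma rep_lyinv : rep 0 (-1) lyinv 1.
Proof. by rewrite /rep /= rmorph1 iota1 expr0 expr1 expr0z !mul1r mulr1. Qed.

(** Writes 1 as y^-1 y, so that it can be added to y^-1 under a common exponent. *)
Lemma rep_lc1 : rep 0 (-1) (lc 1) 'X.
Proof.
rewrite /rep rep1 {2}/iota_y map_polyX -/yF exprN1 !expr0z !mul1r iota1.
by rewrite mulVf // yF_neq0.
Qed.

(** Clearing denominators turns [rep] into an identity of polynomials, which can be differentiated
    or compared coefficientwise. *)
Lemma rep_clear i j q a b p k l k' l' :
  rep i j (q, (a, b)) p -> k'%:Z = i + a%:Z + k%:Z -> l'%:Z = j + b%:Z + l%:Z ->
  q * (vP ^+ k * 'X ^+ l) = vP ^+ k' * 'X ^+ l' * map_poly polyC p.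
Proof.
rewrite /rep /ev => h hk hl; have v0 := vF_neq0; have y0 := yF_neq0.
apply: tau_inj; rewrite !rmorphM !rmorphXn /= -/vF -/yF -/(iota_y p).
have -> : tau q = vF ^ i * yF ^ j * iota_y p * (vF ^+ a * yF ^+ b).
  by rewrite -h mulfVK // mulf_neq0 ?expf_neq0.
have -> : vF ^+ k' = vF ^ i * vF ^+ a * vF ^+ k by rewrite exprnP hk !expfzDr.
have -> : yF ^+ l' = yF ^ j * yF ^+ b * yF ^+ l by rewrite exprnP hl !expfzDr.
ring.
Qed.

Lemma rep_unclear i j q a b p k l k' l' :
  q * (vP ^+ k * 'X ^+ l) = vP ^+ k' * 'X ^+ l' * map_poly polyC p ->
  k'%:Z = i + a%:Z + k%:Z -> l'%:Z = j + b%:Z + l%:Z ->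
  rep i j (q, (a, b)) p.
Proof.
rewrite /rep /ev => h hk hl; have v0 := vF_neq0; have y0 := yF_neq0.
move/(congr1 tau): h; rewrite !rmorphM !rmorphXn /= -/vF -/yF -/(iota_y p).
have -> : vF ^+ k' = vF ^ i * vF ^+ a * vF ^+ k by rewrite exprnP hk !expfzDr.
have -> : yF ^+ l' = yF ^ j * yF ^+ b * yF ^+ l by rewrite exprnP hl !expfzDr.
move=> h; have u0 : vF ^+ k * yF ^+ l != 0 by rewrite mulf_neq0 ?expf_neq0.
have w0 : vF ^+ a * yF ^+ b != 0 by rewrite mulf_neq0 ?expf_neq0.
apply: (mulIf w0); rewrite mulfVK //; apply: (mulIf u0); rewrite h; ring.
Qed.

Lemma rep_lDy i j f p :
  rep i j f p -> rep i (j - 2) (lDy f) (j%:~R *: p + 'X * p^`()).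
Proof.
case: f => q [a b] h.
(* Shifts large enough to make the exponents nonnegative. *)
pose k := absz i; pose l := absz j.
pose k' := absz (i + a%:Z + k%:Z); pose l' := absz (j + b%:Z + l%:Z).
have hk : k'%:Z = i + a%:Z + k%:Z by rewrite /k' /k; lia.
have hl : l'%:Z = j + b%:Z + l%:Z by rewrite /l' /l; lia.
have e := rep_clear h hk hl.
apply: (rep_unclear (k := k) (l := l) (k' := k') (l' := l') _ hk); last first.
  by rewrite hl; lia.
have X_pow m : 'X * ('X ^+ m)^`() = m%:R * 'X ^+ m :> PP.
  rewrite derivXn; case: m => [|m]; first by rewrite mulr0n mulr0 mul0r.
  by rewrite mulrnAr -exprS mulr_natl.
have dV m : (vP ^+ m)^`() = 0 by rewrite -polyC_exp derivC.
have e' : 'X * q^`() * (vP ^+ k * 'X ^+ l) + q * (vP ^+ k * (l%:R * 'X ^+ l)) =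
  vP ^+ k' * (l'%:R * 'X ^+ l') * map_poly polyC p
  + vP ^+ k' * 'X ^+ l' * ('X * map_poly polyC p^`()).
  have := congr1 (fun u : PP => 'X * u^`()) e.
  rewrite /= !derivM !dV -deriv_map !mul0r !add0r -!X_pow => /eqP.
  rewrite -subr_eq0 => /eqP h2; apply/eqP; rewrite -subr_eq0 -[X in _ == X]h2.
  apply/eqP; ring.
have hj : j = l'%:Z - b%:Z - l%:Z by lia.
rewrite rmorphD rmorphM /= map_polyX scaler_int rmorphMz hj !mulrzBr -!pmulrn.
rewrite -!(mulr_natl (map_poly _ _)).
have h3 : b%:R * (q * (vP ^+ k * 'X ^+ l)) =
   b%:R * (vP ^+ k' * 'X ^+ l' * map_poly polyC p) by rewrite e.
have h4 : l%:R * (q * (vP ^+ k * 'X ^+ l)) =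
   l%:R * (vP ^+ k' * 'X ^+ l' * map_poly polyC p) by rewrite e.
transitivity ('X * q^`() * (vP ^+ k * 'X ^+ l) + q * (vP ^+ k * (l%:R * 'X ^+ l))
  - l%:R * (q * (vP ^+ k * 'X ^+ l)) - b%:R * (q * (vP ^+ k * 'X ^+ l))).
  ring.
rewrite e' h3 h4; ring.
Qed.

Lemma lcoef_rep i j f p i' j' : rep i j f p ->
  lcoef f i' j' = if (i' == i) && (0 <= j' - j) then p`_(absz (j' - j)) else 0.
Proof.
case: f => q [a b] h.
(* Both the exponents of the representation and those being read must become nonnegative. *)
pose k := (absz i + absz i')%N; pose l := (absz j + absz j')%N.
pose k' := absz (i + a%:Z + k%:Z); pose l' := absz (j + b%:Z + l%:Z).
have hk : k'%:Z = i + a%:Z + k%:Z by rewrite /k' /k; lia.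
have hl : l'%:Z = j + b%:Z + l%:Z by rewrite /l' /l; lia.
have e := rep_clear h hk hl.
pose I := absz (i' + a%:Z + k%:Z); pose J := absz (j' + b%:Z + l%:Z).
have hI : I%:Z = i' + a%:Z + k%:Z by rewrite /I /k; lia.
have hJ : J%:Z = j' + b%:Z + l%:Z by rewrite /J /l; lia.
have cf (u : PP) k0 l0 : ((u * (vP ^+ k0 * 'X ^+ l0))`_J)`_I =
    if (J < l0)%N || (I < k0)%N then 0 else (u`_(J - l0))`_(I - k0).
  rewrite mulrA -polyC_exp coefMXn; case: ifP => //= _; first by rewrite coef0.
  by rewrite coefMC coefMXn.
have := congr1 (fun u : PP => (u`_J)`_I) e.
rewrite /= (mulrC (_ * _) (map_poly _ _)) !cf /lcoef coef_map coefC /=.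
have -> : (0 <= i' + a%:Z) && (0 <= j' + b%:Z) = ~~ ((J < l)%N || (I < k)%N) by lia.
have -> : (i' == i) && (0 <= j' - j) =
  ~~ ((J < l')%N || (I < k')%N) && ((I - k')%N == 0%N) by lia.
case: (boolP ((J < l)%N || (I < k)%N)) => /= n1.
  case: (boolP ((J < l')%N || (I < k')%N)) => //= n2.
  by have -> : absz (j' - j) = (J - l')%N by lia.
have -> : absz (j' + b%:Z) = (J - l)%N by lia.
have -> : absz (i' + a%:Z) = (I - k)%N by lia.
move=> ->; case: (boolP ((J < l')%N || (I < k')%N)) => //= n2.
by have -> : absz (j' - j) = (J - l')%N by lia.
Qed.

End Laurent.

(** * The series of the statement in rescaled variables *)

Section Transfer.
Variables (KF : fieldType) (tau : {rmorphism PP -> KF}).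
Hypothesis tau_inj : injective tau.
Local Notation rep := (rep tau).
Variable n : nat.

(** F = v^al y^be G under C_a = c_a v^(a-1) y^-2, tested on lists of size n because P is truncated
    there. *)
Definition srep (al be : int) (F : ser) (G : S) : Prop :=
  forall s, size s = n ->
  rep (al + (wt s)%:Z - (mdeg s)%:Z) (be - (2 * mdeg s)%:Z) (F s) (mcoef G s).

Lemma rep_eq i j i' j' f p : rep i j f p -> i = i' -> j = j' -> rep i' j' f p.
Proof. by move=> h <- <-. Qed.

Lemma srep_eq al be al' be' F G :
  srep al be F G -> al = al' -> be = be' -> srep al' be' F G.
Proof. by move=> h <- <-. Qed.

Lemma rep_big (I : eqType) (r : seq I) (F : I -> lau) (p : I -> {poly rat}) i j :
  (forall k, k \in r -> rep i j (F k) (p k)) ->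
  rep i j (\big[ladd/l0]_(k <- r) F k) (\sum_(k <- r) p k).
Proof.
elim: r => [|k r IH] h; first by rewrite !big_nil; apply: rep0.
rewrite !big_cons; apply: (repD tau_inj) => //; first by apply: h; rewrite inE eqxx.
by apply: IH => x hx; apply: h; rewrite inE hx orbT.
Qed.

Lemma srep_const al be x p : rep al be x p -> srep al be (sconst x) (cstS p).
Proof.
move=> h s _; rewrite /sconst /= /cst; case: eqP => [d0|_]; last exact: rep0.
by rewrite d0 (wt_mdeg0 d0); apply: rep_eq h _ _; lia.
Qed.

Lemma srep_add al be F G F' G' :
  srep al be F G -> srep al be F' G' -> srep al be (sadd F F') (G + G').
Proof. by move=> h h' s hs; apply: (repD tau_inj); [apply: h | apply: h']. Qed.

Lemma srep_scal i j al be x p F G :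
  rep i j x p -> srep al be F G -> srep (i + al) (j + be) (sscal x F) (cstS p * G).
Proof.
move=> hx h s hs; rewrite mcoef_cstM.
by apply: rep_eq (repM tau_inj hx (h s hs)) _ _; lia.
Qed.

Lemma srep_mul al be al' be' F G F' G' :
  srep al be F G -> srep al' be' F' G' ->
  srep (al + al') (be + be') (smul F F') (G * G').
Proof.
move=> h h' s hs; apply: rep_big => t ht.
have [s1 s2] := size_divs ht; rewrite hs in s1 s2.
have hd := mdeg_divs ht; have hw := wt_divs ht.
by apply: rep_eq (repM tau_inj (h _ s1) (h' _ s2)) _ _; lia.
Qed.

Lemma srep_pow al be F G k :
  srep al be F G -> srep (al *+ k) (be *+ k) (spow F k) (G ^+ k).
Proof.
move=> h; elim: k => [|k IH]; last by rewrite !mulrS exprS; apply: srep_mul.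
by rewrite !mulr0n expr0 -(rmorph1 (@cstS _)); apply: srep_const; apply: rep1.
Qed.

Lemma srep_Dy al b F G :
  srep al b%:Z F G -> srep al (b%:Z - 2) (sDy F) (dy G + b%:R * G).
Proof.
move=> h s hs.
have -> : mcoef (dy G + b%:R * G) s =
    (b%:Z - (2 * mdeg s)%:Z)%:~R *: mcoef G s + 'X * (mcoef G s)^`().
  rewrite mcoefD -(rmorph_nat (@cstS _)) mcoef_cstM /= scale1r.
  rewrite rmorphB /= -!pmulrn natrM -!mul_polyC; ring.
by apply: rep_eq (rep_lDy tau_inj (h s hs)) _ _; lia.
Qed.

Lemma srep_iter_Dy al k F G :
  srep al (k.*2.+1)%:Z F G -> srep al 1 (iter k sDy F) (rising dy k G).
Proof.
elim: k F G => [|k IH] F G h //; rewrite iterSr /=; apply: IH.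
have := srep_Dy h; rewrite (_ : _%:Z - 2 = (k.*2.+1)%:Z); last by lia.
by rewrite doubleS.
Qed.

Lemma srep_ssum al be (F : nat -> ser) (G : nat -> S) s :
  (forall r, srep al be (F r) (G r)) -> size s = n ->
  rep (al + (wt s)%:Z - (mdeg s)%:Z) (be - (2 * mdeg s)%:Z) (ssum F s)
    (mcoef (\sum_(r < (mdeg s).+1) G r) s).
Proof.
by move=> h hs; rewrite mcoef_sum /ssum; apply: rep_big => r _; apply: h.
Qed.

Local Notation A := ((pgen n).[(1 + yS) ^+ 2]).

Lemma yS1E : 1 + yS = cstS (1 + 'X).
Proof. by rewrite rmorphD rmorph1. Qed.

Lemma mcoef_A s : size s = n ->
  mcoef A s = \sum_(a < size s) (if cmon a s then (1 + 'X) ^+ (2 * a) else 0).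
Proof.
move=> hs; rewrite horner_poly mcoef_sum hs; apply: eq_bigr => a _.
rewrite yS1E -!rmorphXn mulrC mcoef_cstM /= -exprM.
by case: (cmon a s); rewrite ?mulr1 ?mulr0.
Qed.

Lemma srep_A : srep 0 2 Aser A.
Proof.
have hX : rep 1 0 (lmul lv (lpow (ladd (lc 1) ly) 2)) ((1 + 'X) ^+ 2).
  have h := repX tau_inj 2 (repD tau_inj (rep1 tau) (rep_ly' tau)).
  by have := repM tau_inj (rep_lv tau) h; rewrite mul1r.
have hP : srep 1 2 (Pser (lmul lv (lpow (ladd (lc 1) ly) 2))) A.
  move=> s hs; rewrite (mcoef_A hs); apply: rep_big => a _.
  case: ifP => [ha|_]; last exact: rep0.
  have /andP[/eqP d1 _] := ha.
  rewrite d1 (cmon_wt ha) exprM; apply: rep_eq (repX tau_inj a hX) _ _; last by lia.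
  by rewrite -mulr_natl mulr1; lia.
have := srep_scal (rep_lvinv tau) hP.
by rewrite rmorph1 mul1r.
Qed.

Definition Tterm (r : nat) : S :=
  if r is r'.+1
  then cstS (r`!%:R^-1)%:P * rising dy r' ((1 + yS) * A ^+ r) else 0.

Lemma srep_Tterm r : srep 0 1
  (if r is r'.+1 then
     sscal (lc (r`!%:R)^-1)
       (iter r' sDy (sscal (ladd lyinv (lc 1)) (spow Aser r)))
   else szero) (Tterm r).
Proof.
case: r => [|r]; first by move=> s _; apply: rep0.
have hy : rep 0 (-1) (ladd lyinv (lc 1)) (1 + 'X).
  by apply: (repD tau_inj); [apply: rep_lyinv | apply: rep_lc1].
have h1 := srep_scal hy (srep_pow r.+1 srep_A); rewrite -yS1E in h1.
(* The exponent is 2 (r + 1) from the power of A, less 1 from the factor 1/y. *)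
have h2 : srep 0 (r.*2.+1)%:Z (sscal (ladd lyinv (lc 1)) (spow Aser r.+1))
    ((1 + yS) * A ^+ r.+1).
  by apply: srep_eq h1 _ _; rewrite ?mul0rn // -mulr_natr; lia.
exact: srep_eq (srep_scal (rep_lc tau _) (srep_iter_Dy h2)) _ _.
Qed.

Variables (Z : S) (Z1 : vord 1 (Z - 1)).
Local Notation X := (1 + yS * Z).
Local Notation B := ((pgen n).[X ^+ 2]).
Hypothesis ZE : Z ^+ 2 = 1 + 2 * B.

(** Lagrange inversion, T = Y + A(v, Y): by homogeneity only r = mdeg s contributes, and
    [lagrange_coef] identifies that term. *)
Lemma mcoef_Tterm s : mcoef (1 + \sum_(r < (mdeg s).+1) Tterm r) s = mcoef (Z + yS * B) s.
Proof.
have hA r k : homog r (rising dy k ((1 + yS) * A ^+ r)).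
  apply: homog_rising; rewrite yS1E -(add0n r); apply: homogM; first exact: homog_cst.
  rewrite -[X in homog X]mul1n; apply: homogX; rewrite horner_poly => t ht.
  rewrite mcoef_sum big1 // => a _.
  rewrite -!rmorphXn mulrC mcoef_cstM homog_gen ?mulr0 //.
rewrite (mcoefD 1) mcoef_sum; case hs : (mdeg s) => [|d].
  rewrite big_ord1 mcoef1 /cst hs eqxx -[Tterm _]/(0 : S) mcoef0 addr0.
  exact: esym (mcoefG0 erefl Z1 hs).
rewrite mcoef1 /cst hs add0r big_ord_recr big1 => [|i _].
  rewrite [LHS]add0r /Tterm [nat_of_ord _]/= mcoef_cstM mul_polyC; apply: esym.
  exact: (lagrange_coef erefl erefl erefl erefl Z1 ZE hs).
case: i => -[|i] hi //; rewrite /Tterm [nat_of_ord _]/= mcoef_cstM hA ?mulr0 // hs => e.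
by rewrite e ltnn in hi.
Qed.

Lemma srep_Tser : srep 0 1 Tser (Z + yS * B).
Proof.
move=> s hs; rewrite -mcoef_Tterm mcoefD; apply: (repD tau_inj).
  by have := srep_const (rep_ly tau) hs; rewrite rmorph1.
exact: srep_ssum srep_Tterm hs.
Qed.

Local Notation E := (1 + halfS * (Z + yS * B - 1)).

Lemma srep_eps : srep 0 0 epsser (halfS * (Z + yS * B - 1)).
Proof.
have h1 : rep 0 1 (lmul (lc (-1)) ly) (-1).
  have := repM tau_inj (rep_lc tau (-1)) (rep_ly tau).
  by rewrite mulr1 polyCN polyC1.
have h2 : rep 0 (-1) (lmul (lc (1/2)) lyinv) (1 / 2)%:P.
  by have := repM tau_inj (rep_lc tau (1 / 2)) (rep_lyinv tau); rewrite mulr1.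
have := srep_scal h2 (srep_add srep_Tser (srep_const h1)).
by rewrite rmorphN1.
Qed.

(** The exponent -N comes from y^-N (1 + eps)^-N; cutting the binomial series at mdeg s is harmless
    by [nbE]. *)
Lemma rep_Tnegpow N Ei s : E * Ei = 1 -> size s = n ->
  rep ((wt s)%:Z - (mdeg s)%:Z) (- N%:Z - (2 * mdeg s)%:Z) (Tnegpow N s)
    (mcoef (Ei ^+ N) s).
Proof.
move=> EiE hs.
have e1 : vord 1 (halfS * (Z + yS * B - 1)).
  apply: vordMl; rewrite addrAC; apply: vordD => //; apply: vordMl.
  exact: vord_pgen.
have -> : mcoef (Ei ^+ N) s =
    mcoef (nb N (mdeg s).+1 (halfS * (Z + yS * B - 1))) s.
  by apply: (@eq_vord (mdeg s).+1) => //; apply: nbE.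
have hk k : srep 0 0 (sscal (lc ((-1) ^+ k * ('C(N + k - 1, k))%:R)) (spow epsser k))
    (nbc N k * (halfS * (Z + yS * B - 1)) ^+ k).
  apply: srep_eq (srep_scal (rep_lc tau _) (srep_pow k srep_eps)) _ _;
  by rewrite mul0rn.
have h1 := srep_ssum hk hs.
have h2 := repX tau_inj N (rep_lyinv tau).
have := repM tau_inj h2 h1; rewrite expr1n mul1r => h3.
rewrite /nb; apply: rep_eq h3 _ _; first by rewrite mul0rn; lia.
by rewrite mulNrn -[1 *+ N]/(N%:R) natz; lia.
Qed.

End Transfer.

(* For every monomial c^s, the coefficient of v^(N-1) y^(-2) c^s in
   ((T+y)/2)^(-N) equals that of  -1/4 N binom(2N+2,N+1) c_N. *)
Theorem theorem2 (N : nat) (hN : (1 <= N)%N) (s : seq nat) :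
  lcoef (Tnegpow N s) (N%:Z - 1) (-2) =
  (if cmon N s then - (1/4) * N%:R * ('C(2 * N + 2, N + 1))%:R else 0).
Proof.
have [Z [Z1 ZE]] := curve_exists (size s).
set B := (pgen _).[_] in ZE.
have e1 : vord 1 (halfS * (Z + yS * B - 1)).
  apply: vordMl; rewrite addrAC; apply: vordD => //; apply: vordMl.
  exact: vord_pgen.
have [Ei EiE] := inv_exists e1.
have EE : 2 * (1 + halfS * (Z + yS * B - 1)) = 1 + (Z + yS * B).
  by rewrite mulrDr mulrA halfS2; ring.
case: N hN => // N _.
have tau_inj : injective (@tofrac {poly {poly rat}}).
  by move=> a b /eqP; rewrite tofrac_eq => /eqP.
have h := rep_Tnegpow tau_inj Z1 ZE N.+1 EiE erefl.
rewrite (lcoef_rep tau_inj _ _ h).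
(* With N + 1 for the original N, the condition says wt s = N + mdeg s and that the y-index 2 mdeg s
   + N - 1 is nonnegative. *)
case: (boolP (_ && _)) => hc.
  have hw : wt s = (N + mdeg s)%N by lia.
  rewrite -/(scoef s _ _).
  by apply: (scoef_Ei erefl erefl erefl erefl Z1 ZE EE EiE erefl hw); lia.
(* The monomial of the claimed answer satisfies that condition, so it cannot occur here. *)
case: ifP => // hs; have /andP[/eqP d1 _] := hs.
by have := cmon_wt hs; lia.
Qed.
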